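(* Let $M$ be a loopless matroid of rank $3$. Then $\mathcal{P}$ is exactly the set of combinatorially nef divisors in $A^1(M)$. Equivalently, for every combinatorially nef $\ell\in A^1(M)$ with corresponding line bundle $[\mathcal{L}]\in K(M)$, $c_1([\mathcal{L}])=\ell$, one has $(-1)^{r-1}\deg_M(\zeta_M(-[\mathcal{L}]))\ge0$ (with $r=3$).
   Context: ''Proper flat'' means a flat $F$ with $\varnothing\ne F\ne E$. For a loopless matroid $M$ on $E$, $X_M$ is the smooth toric variety of the Bergman fan of $M$ (the fan in $\mathbb{R}^E/\mathbb{R}(1,\dots,1)$ whose cones are generated by $\{\sum_{i\in F}e_i:F\in\mathcal{F}\}$ for flags $\mathcal{F}$, possibly empty, of proper flats). $A^*(M)=A^*(X_M)=\mathbb{Z}[x_F:F\text{ proper flat}]/(I+J)$, with $I$ generated by $x_Fx_G$ for incomparable $F,G$ and $J$ by $\sum_{F\ni i}x_F-\sum_{F\ni j}x_F$. $K(M)=K(X_M)$ is the Grothendieck ring of vector bundles. For $M$ of rank $r$, $\deg_M:A^{r-1}(M)\to\mathbb{Z}$ is the isomorphism sending $x_{F_1}\cdots x_{F_{r-1}}$ to $1$ for every complete flag of proper flats, extended by $0$ to other degrees. $\alpha=\sum_{F\ni i}x_F$ (independent of $i$); $\alpha_F=\alpha-\sum_{\text{proper flats }G\supseteq F}x_G$ for a nonempty flat $F$. $l\in A^1(M)$ is combinatorially nef if for every flag $\mathcal{F}=(F_1\subsetneq\cdots\subsetneq F_k)$ of proper flats (including the empty flag) there is an expression $l=\sum_Fc_Fx_F$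 with rational coefficients such that $c_{F_i}=0$ for all $i$ and $c_F\ge0$ for every proper flat $F$ such that $\mathcal{F}\sqcup\{F\}$ is again a flag. $\zeta_M:K(M)\to A^*(M)$ is the unique ring isomorphism sending $[\mathcal{L}_F]\mapsto1+\alpha_F+\alpha_F^2+\cdots$ for every nonempty flat $F$, where $\mathcal{L}_F$ is the line bundle with $c_1=\alpha_F$. Line bundle classes are written additively: $-[\mathcal{L}]$ is the class of the inverse line bundle, not the additive inverse in $K(M)$. For $0\le i\le r-1$, $N_i\subset A^i(M)$ is the set of elements expressible as a product of $i$ combinatorially nef divisors, and $P_i\subset A^i(M)$ is the set of elements expressible as a nonnegative linear combination of elements of $N_i$. $\mathcal{P}\subset A^1(M)$ is the set of divisors $\ell$ such that, with $[\mathcal{L}]$ the line bundle with $c_1([\mathcal{L}])=\ell$, $(-1)^i$ times the degree-$i$ part of $\zeta_M(-[\mathcal{L}])$ lies in $P_i$ for all $i$. *)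

(* Defs.v *)
From HB Require Import structures.
From mathcomp Require Import all_boot all_order all_algebra fraction.
From mathcomp Require Import generic_quotient ring_quotient.
From mathcomp Require Import boolp.
From mathcomp Require Import -(notations) monalg.
From mathcomp Require Import mpoly.

Set Implicit Arguments.
Unset Strict Implicit.
Unset Printing Implicit Defensive.

Import Order.TTheory GRing.Theory Num.Theory.
Local Open Scope ring_scope.
Local Open Scope quotient_scope.

(******************************************************************************)
(* Quotient of a commutative ring by the ideal generated by a set G.          *)
(* {ideal_quot I} of ring_quotient is a ring only when I is known to be       *)
(* proper, so the (possibly zero) ring structure is put on it here.           *)
(******************************************************************************)

Definition ideal_gen (R : comPzRingType) (G : R -> Prop) (x : R) : Prop :=
  exists s : seq (R * R),
    (forall p, p \in s -> G p.2) /\ x = \sum_(p <- s) p.1 * p.2.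

Definition ideal_genb (R : comPzRingType) (G : R -> Prop) : {pred R} :=
  fun x => `[< ideal_gen G x >].

Section IdealGen.
Variables (R : comPzRingType) (G : R -> Prop).

Lemma ideal_gen_add x y : ideal_gen G x -> ideal_gen G y -> ideal_gen G (x + y).
Proof.
move=> [s [Gs ->]] [t [Gt ->]]; exists (s ++ t); rewrite big_cat; split=> // p.
by rewrite mem_cat => /orP[/Gs|/Gt].
Qed.

Lemma ideal_gen_mul a x : ideal_gen G x -> ideal_gen G (a * x).
Proof.
move=> [s [Gs ->]]; exists [seq (a * p.1, p.2) | p <- s]; split.
  by move=> _ /mapP[p /Gs Gp ->].
by rewrite big_map big_distrr; apply: eq_bigr => p _ /=; rewrite mulrA.
Qed.

Lemma ideal_genb_zmod : zmod_closed (ideal_genb G).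
Proof.
split=> [|x y /asboolP Gx /asboolP Gy].
  by apply/asboolP; exists [::]; rewrite big_nil.
apply/asboolP/ideal_gen_add => //; rewrite -mulN1r; exact: ideal_gen_mul.
Qed.

HB.instance Definition _ :=
  GRing.isZmodClosed.Build R (ideal_genb G) ideal_genb_zmod.

Definition quot_ring : Type := @Quotient.quot R (ideal_genb G).
HB.instance Definition _ := GRing.Zmodule.on quot_ring.
HB.instance Definition _ := EqQuotient.on quot_ring.

Definition quot_pi (x : R) : quot_ring := \pi x.

Lemma quot_piP x y : reflect (ideal_gen G (x - y)) (quot_pi x == quot_pi y).
Proof.
by rewrite -[_ == _](@Quotient.idealrBE R (ideal_genb G)); exact: asboolP.
Qed.

Lemma quot_pi_gen x : G x -> quot_pi x = quot_pi 0.
Proof.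
move=> Gx; apply/eqP/quot_piP; exists [:: (1, x)]; rewrite big_seq1 mul1r subr0.
by split=> // p /[1!inE] /eqP->.
Qed.

Lemma quot_piK (x : quot_ring) : quot_pi (repr x) = x.
Proof. exact: reprK. Qed.

Definition quot_mul (x y : quot_ring) : quot_ring := quot_pi (repr x * repr y).

Lemma quot_piM x y : quot_pi (x * y) = quot_mul (quot_pi x) (quot_pi y).
Proof.
apply/eqP/quot_piP; set x' := repr _; set y' := repr _.
rewrite (_ : x * y - _ = y * (x - x') + x' * (y - y')); last first.
  by rewrite !mulrBr [y * x]mulrC [y * x']mulrC addrA subrK.
apply: ideal_gen_add; apply: ideal_gen_mul; apply/quot_piP;
  by rewrite quot_piK.
Qed.

Lemma quot_mulA : associative quot_mul.
Proof.
move=> x y z; rewrite -[x]quot_piK -[y]quot_piK -[z]quot_piK.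
by rewrite -!quot_piM mulrA.
Qed.

Lemma quot_mulC : commutative quot_mul.
Proof. by move=> x y; rewrite /quot_mul mulrC. Qed.

Lemma quot_mul1 : left_id (quot_pi 1) quot_mul.
Proof. by move=> x; rewrite -[x]quot_piK -quot_piM mul1r. Qed.

Lemma quot_piB : {morph quot_pi : x y / x - y}.
Proof. by move=> x y; exact: (raddfB \pi_(@Quotient.quot R (ideal_genb G))). Qed.

Lemma quot_piD : {morph quot_pi : x y / x + y}.
Proof. by move=> x y; exact: (raddfD \pi_(@Quotient.quot R (ideal_genb G))). Qed.

Lemma quot_mulDl : left_distributive quot_mul +%R.
Proof.
move=> x y z; rewrite -[x]quot_piK -[y]quot_piK -[z]quot_piK.
by rewrite -!(quot_piM, quot_piD) mulrDl.
Qed.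

HB.instance Definition _ := GRing.Zmodule_isComPzRing.Build quot_ring
  quot_mulA quot_mulC quot_mul1 quot_mulDl.

HB.instance Definition _ := GRing.isZmodMorphism.Build R quot_ring quot_pi quot_piB.
HB.instance Definition _ := GRing.isMonoidMorphism.Build R quot_ring quot_pi
  (conj erefl quot_piM).

End IdealGen.

Record matroid (E : finType) := Matroid {
  indep : {set {set E}};
  indep0 : set0 \in indep;
  indepS : forall I J : {set E}, J \in indep -> I \subset J -> I \in indep;
  indep_aug : forall I J : {set E}, I \in indep -> J \in indep ->
    (#|I| < #|J|)%N -> exists2 e, e \in J :\: I & e |: I \in indep
}.

Section Matroid.
Variables (E : finType) (M : matroid E).

Definition loopless : bool := [forall e, [set e] \in indep M].

Definition rk (A : {set E}) : nat :=
  (\max_(I in indep M | I \subset A) #|I|)%N.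

Definition rank : nat := rk [set: E].

Definition flat (F : {set E}) : bool :=
  [forall e in ~: F, (rk F < rk (e |: F))%N].

Definition proper_flat (F : {set E}) : bool :=
  [&& flat F, F != set0 & F != [set: E]].

Definition pflat : Type := {F : {set E} | proper_flat F}.
HB.instance Definition _ := Finite.on pflat.

Definition comparable (F G : {set E}) : bool := (F \subset G) || (G \subset F).

Definition is_flag (S : {set pflat}) : bool :=
  [forall F in S, forall G in S, comparable (val F) (val G)].

Definition flag : Type := {S : {set pflat} | is_flag S}.
HB.instance Definition _ := Finite.on flag.

Section Chow.
Variable R : comNzRingType.

Definition chow_var (F : pflat) : {mpoly R[#|{: pflat}|]} := 'X_(enum_rank F).

Inductive chow_rel : {mpoly R[#|{: pflat}|]} -> Prop :=
| ChowIncomparable (F G : pflat) of ~~ comparable (val F) (val G) :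
    chow_rel (chow_var F * chow_var G)
| ChowLinear (i j : E) :
    chow_rel (\sum_(F : pflat | i \in val F) chow_var F
              - \sum_(F : pflat | j \in val F) chow_var F).

Definition chow : Type := quot_ring chow_rel.
HB.instance Definition _ := GRing.ComPzRing.on chow.
HB.instance Definition _ := EqQuotient.on chow.

Definition chow_class : {mpoly R[#|{: pflat}|]} -> chow := @quot_pi _ chow_rel.
HB.instance Definition _ := GRing.RMorphism.on chow_class.

Definition chow_deg (i : nat) (a : chow) : Prop :=
  exists2 p, p \is i.-homog & a = chow_class p.

(* The degree-i part of a. The relations are homogeneous, so the result does  *)
(* not depend on the polynomial representing a.                               *)
Definition chow_part (i : nat) (a : chow) : chow :=
  chow_class (pihomog mdeg i (repr a)).

End Chow.

(* The canonical map A^*(M) -> A^*(M) (x) R. *)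
Definition chow_ext (R : comNzRingType) (a : chow int) : chow R :=
  chow_class (map_mpoly intr (repr a)).

Definition x_ (F : pflat) : chow int := chow_class (chow_var int F).

(* The sum does not depend on i : E. *)
Definition alpha : chow int :=
  if [pick i : E] is Some i then \sum_(F : pflat | i \in val F) x_ F else 0.

(* For any nonempty flat F, possibly F = E. *)
Definition alpha_ (F : {set E}) : chow int :=
  alpha - \sum_(G : pflat | F \subset val G) x_ G.

Definition is_degree_map (deg : {additive chow int -> int}) : Prop :=
  [/\ forall i a, i != rank.-1 -> chow_deg i a -> deg a = 0,
      forall S : flag, #|val S| = rank.-1 -> deg (\prod_(F in val S) x_ F) = 1,
      forall a, chow_deg rank.-1 a -> deg a = 0 -> a = 0
    & forall n, exists2 a, chow_deg rank.-1 a & deg a = n].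

Definition comb_nef (l : chow int) : Prop :=
  chow_deg 1 l /\
  forall S : flag, exists c : pflat -> rat,
    [/\ chow_ext rat l = \sum_F chow_class (c F *: chow_var rat F),
        forall F, F \in val S -> c F = 0
      & forall F, F \notin val S -> is_flag (F |: val S) -> 0 <= c F].

Definition nef_products (i : nat) (a : chow int) : Prop :=
  exists2 l : i.-tuple (chow int),
    (forall j, comb_nef (tnth l j)) & a = \prod_j tnth l j.

(* Nonnegative linear combinations with coefficients in R, taken in           *)
(* A^*(M) (x) R; R = int gives the combinations inside A^i(M) itself.         *)
Definition nef_cone (R : numDomainType) (i : nat) (a : chow int) : Prop :=
  chow_deg i a /\
  exists s : seq (R * chow int),
    (forall p, p \in s -> 0 <= p.1 /\ nef_products i p.2) /\
    chow_ext R a = \sum_(p <- s) chow_class p.1%:MP * chow_ext R p.2.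

End Matroid.

(******************************************************************************)
(* The toric variety X_M over the field k and its vector bundles              *)
(*                                                                            *)
(* X_M is covered by the affine charts U_S, one for each flag S. The          *)
(* character lattice is {m in Z^E | sum m = 0}, and the coordinate ring of    *)
(* U_S is spanned by the characters that are nonnegative on the cone of S.    *)
(* All these rings are subrings of the field k(t_e : e in E).                 *)
(******************************************************************************)

Section Toric.
Variables (k : fieldType) (E : finType) (M : matroid E).

Definition ratfun : fieldType := {fraction {mpoly k[#|E|]}}.

Definition character (m : {ffun E -> int}) : ratfun :=
  \prod_e (tofrac 'X_(enum_rank e)) ^ m e.

(* The sections over U_S of O(D), where D = sum_F c_F D_F and D_F is the      *)
(* torus-invariant prime divisor of the ray of F.                             *)
Definition div_sections (S : flag M) (c : pflat M -> int) (f : ratfun) : Prop :=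
  exists s : seq (k * {ffun E -> int}),
    (forall p, p \in s -> \sum_e p.2 e = 0 /\
       forall F : pflat M, F \in val S -> - c F <= \sum_(e in val F) p.2 e) /\
    f = \sum_(p <- s) tofrac p.1%:MP * character p.2.

Definition coord_ring (S : flag M) : ratfun -> Prop := div_sections S (fun=> 0).

Definition span_over (S : flag M) (n : nat) (V : 'rV[ratfun]_n -> Prop)
    (v : 'rV[ratfun]_n) : Prop :=
  exists s : seq (ratfun * 'rV[ratfun]_n),
    (forall p, p \in s -> coord_ring S p.1 /\ V p.2) /\
    v = \sum_(p <- s) p.1 *: p.2.

Implicit Types (S T : flag M) (c d : pflat M -> int).

Lemma character0 : character 0 = 1.
Proof. by rewrite /character big1 // => e _; rewrite ffunE expr0z. Qed.

Lemma characterD m n : character (m + n) = character m * character n.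
Proof.
rewrite /character -big_split; apply: eq_bigr => e _ /=; rewrite ffunE expfzDr //.
by rewrite tofrac_eq0 -msupp_eq0 msuppX.
Qed.

Lemma div_sections_char S c (m : {ffun E -> int}) : \sum_e m e = 0 ->
  (forall F, F \in val S -> - c F <= \sum_(e in val F) m e) ->
  div_sections S c (character m).
Proof.
move=> m0 mF; exists [:: (1, m)]; split; last by rewrite big_seq1 !rmorph1 mul1r.
by move=> p; rewrite inE => /eqP->.
Qed.

Lemma div_sectionsD S c f g :
  div_sections S c f -> div_sections S c g -> div_sections S c (f + g).
Proof.
move=> [s [Ps ->]] [t [Pt ->]]; exists (s ++ t); rewrite big_cat; split=> // p.
by rewrite mem_cat => /orP[/Ps|/Pt].
Qed.

Lemma div_sections_sum S c (I : eqType) (r : seq I) (F : I -> ratfun) :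
  (forall i, i \in r -> div_sections S c (F i)) ->
  div_sections S c (\sum_(i <- r) F i).
Proof.
elim: r => [|i r IHr] Fr; first by rewrite big_nil; exists [::]; rewrite big_nil.
rewrite big_cons; apply: div_sectionsD; first by apply: Fr; rewrite mem_head.
by apply: IHr => j jr; apply: Fr; rewrite inE jr orbT.
Qed.

Lemma div_sectionsM S c d e f g : (forall F, F \in val S -> e F = c F + d F) ->
  div_sections S c f -> div_sections S d g -> div_sections S e (f * g).
Proof.
move=> De [s [Ps ->]] [t [Pt ->]]; rewrite big_distrl; apply: div_sections_sum => p ps.
rewrite big_distrr; apply: div_sections_sum => q qt /=.
have [p0 pF] := Ps p ps; have [q0 qF] := Pt q qt.
exists [:: (p.1 * q.1, p.2 + q.2)]; split; last first.
  by rewrite big_seq1 /= characterD !rmorphM mulrACA.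
move=> _ /[1!inE] /eqP-> /=; have ->: \sum_e0 (p.2 + q.2) e0 = 0.
  by under eq_bigr do rewrite ffunE; rewrite big_split /= p0 q0.
split=> // F FS; under eq_bigr do rewrite ffunE.
by rewrite big_split /= De // opprD lerD ?pF ?qF.
Qed.

(* The cones are smooth: a divisor is principal on each chart. *)
Lemma chart_equation S c : exists m : {ffun E -> int},
  \sum_e m e = 0 /\ forall F, F \in val S -> \sum_(e in val F) m e = c F.
Proof.
have [A defA] : {A | val S = A} by exists (val S).
have: is_flag A by rewrite -defA; exact: valP S.
rewrite defA; move: {S defA}A => A.
have [n] := ubnP #|A|; elim: n A => // n IHn A leAn /'forall_in_'forall_in_idP-flA.
have [->|[G GA]] := set_0Vmem A.
  by exists 0; split=> [|F]; rewrite ?inE // big1 // => e _; rewrite ffunE.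
pose F0 := [arg max_(F > G in A) #|val F|].
have [F0A maxF0]: F0 \in A /\ forall F, F \in A -> (#|val F| <= #|val F0|)%N.
  by rewrite /F0; case: arg_maxnP.
have subF0 F : F \in A -> val F \subset val F0.
  move=> FA; have /orP[//|sF0F] := flA _ FA _ F0A.
  by have /eqP-> : val F0 == val F by rewrite eqEcard sF0F maxF0.
pose B := A :\ F0.
have flB : is_flag B.
  apply/forall_inP => F /setD1P[_ FA]; apply/forall_inP => H /setD1P[_ HA]; exact: flA.
have [|m [m0 mF]] := IHn B _ flB.
  by rewrite -ltnS (leq_trans _ leAn) // [#|A|](cardsD1 F0) F0A ltnS.
have [i iF0 iB] : exists2 i, i \in val F0 & forall F, F \in B -> i \notin val F.
  have [B0|[H HB]] := set_0Vmem B.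
    have /and3P[_ /set0Pn[i iF0] _] := valP F0.
    by exists i => // F; rewrite B0 inE.
  pose F1 := [arg max_(F > H in B) #|val F|].
  have [F1B maxF1]: F1 \in B /\ forall F, F \in B -> (#|val F| <= #|val F1|)%N.
    by rewrite /F1; case: arg_maxnP.
  have /setD1P[F1F0 F1A] := F1B.
  have: ~~ (val F0 \subset val F1).
    apply: contra F1F0 => sF01; rewrite -val_eqE eqEsubset sF01 andbT; exact: subF0.
  case/subsetPn => i iF0 iF1; exists i => // F FB.
  have /setD1P[_ FA] := FB; have /orP[sFF1|sF1F] := flA _ FA _ F1A.
    by apply: contra iF1; exact: (subsetP sFF1).
  by have /eqP<- : val F1 == val F by rewrite eqEcard sF1F maxF1.
have [j jF0] : exists j, j \notin val F0.
  have /and3P[_ _ ntF0] := valP F0.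
  have /subsetPn[j _ jF0] : ~~ ([set: E] \subset val F0) by rewrite subTset.
  by exists j.
pose a := c F0 - \sum_(e in val F0) m e.
pose u := [ffun e => if e == i then a else if e == j then - a else 0 : int].
have ij : j != i by apply: contraNneq jF0 => ->.
exists (m + u); split.
  under eq_bigr do rewrite ffunE.
  rewrite big_split /= m0 add0r (bigD1 i) //= (bigD1 j) //= !ffunE !eqxx (negPf ij).
  by rewrite big1 ?addr0 ?subrr // => e /andP[/negPf ei /negPf ej]; rewrite ffunE ei ej.
move=> F FA; under eq_bigr do rewrite ffunE.
have jF : j \notin val F by apply: contra jF0; exact: (subsetP (subF0 F FA)).
rewrite big_split /=; have [DF|neF] := eqVneq F F0.
  rewrite DF [X in _ + X](bigD1 i) //= ffunE eqxx.
  rewrite [X in _ + (_ + X)]big1 => [|e]; first by rewrite addr0 addrC subrK.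
  case/andP=> eF /negPf ei; rewrite ffunE ei.
  by case: eqP eF => // ->; rewrite (negPf jF0).
have FB : F \in B by rewrite !inE neF.
rewrite mF // big1 ?addr0 // => e eF; rewrite ffunE.
have /negPf-> : e != i by apply: contraTneq eF => ->; exact: iB.
by have /negPf-> : e != j by apply: contraTneq eF => ->.
Qed.

(* A vector bundle of rank n, as a locally free sheaf inside its generic      *)
(* fibre: finitely generated projective modules over the coordinate rings of  *)
(* the charts, compatible with restriction to smaller charts. In sect_proj,   *)
(* the rows of A generate the module and the columns of B are the dual        *)
(* functionals (dual basis lemma); B *m A = 1 also forces the rank to be n.   *)
Record bundle (n : nat) := Bundle {
  sect :> flag M -> 'rV[ratfun]_n -> Prop;
  sect_proj : forall S, exists N (A : 'M[ratfun]_(N, n)) (B : 'M[ratfun]_(n, N)),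
    [/\ forall v, sect S v <->
          exists2 u : 'rV_N, (forall j, coord_ring S (u 0 j)) & v = u *m A,
        B *m A = 1%:M
      & forall i j, coord_ring S ((A *m B) i j)];
  sect_glue : forall S T : flag M, val T \subset val S ->
    forall v, sect T v <-> span_over T (sect S) v
}.

Definition isom_bundle n (V W : bundle n) : Prop :=
  exists2 g : 'M[ratfun]_n, g \in unitmx & forall S v, V S v <-> W S (v *m g).

(* 0 -> V -> W -> Z -> 0, exact on every chart. *)
Definition short_exact n p q (V : bundle n) (W : bundle p) (Z : bundle q) : Prop :=
  exists (f : 'M[ratfun]_(n, p)) (g : 'M[ratfun]_(p, q)), forall S,
    [/\ forall u, V S u -> W S (u *m f) /\ (u *m f = 0 -> u = 0),
        forall w, W S w ->
          (w *m g = 0 <-> exists2 u, V S u & w = u *m f)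
      & forall z, Z S z <-> exists2 w, W S w & z = w *m g].

(* Z is V (x) W, with 'rV_n (x) 'rV_p identified with 'rV_(n * p). *)
Definition is_tensor n p (V : bundle n) (W : bundle p) (Z : bundle (n * p)) : Prop :=
  forall S z, Z S z <->
    span_over S (fun t => exists v w, [/\ V S v, W S w & t = mxvec (v^T *m w)]) z.

Section LineBundle.
Variable c : pflat M -> int.

Let sect1 S (v : 'rV[ratfun]_1) : Prop := div_sections S c (v 0 0).

Lemma line_bundle_proj S :
  exists N (A : 'M[ratfun]_(N, 1)) (B : 'M[ratfun]_(1, N)),
    [/\ forall v, sect1 S v <->
          exists2 u : 'rV_N, (forall j, coord_ring S (u 0 j)) & v = u *m A,
        B *m A = 1%:M
      & forall i j, coord_ring S ((A *m B) i j)].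
Proof.
have [m [m0 mF]] := chart_equation S c.
have mm : character (- m) * character m = 1 by rewrite -characterD addNr character0.
have Nm0 : \sum_e (- m) e = 0.
  by under eq_bigr do rewrite ffunE; rewrite sumrN m0 oppr0.
have one0 : coord_ring S 1.
  rewrite -character0; apply: div_sections_char => [|F _].
    by rewrite big1 // => e _; rewrite ffunE.
  by rewrite big1 // => e _; rewrite ffunE.
exists 1%N, (character (- m))%:M, (character m)%:M; split.
- move=> v; split=> [cv|[u cu ->]]; last first.
    rewrite /sect1 mul_mx_scalar mxE mulrC; apply: (div_sectionsM (c := fun=> 0) (d := c)) (cu 0) _; last first.
      apply: (div_sections_char (c := c)) => // F FS; under eq_bigr do rewrite ffunE.
      by rewrite sumrN mF.
    by move=> F _; rewrite add0r.
  exists (character m *: v) => [j|]; last first.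
    by rewrite mul_mx_scalar scalerA mm scale1r.
  rewrite mxE [j]ord1.
  apply: (div_sectionsM (c := fun F => - c F) (d := c)) _ cv; last first.
    by apply: div_sections_char => // F FS; rewrite mF ?opprK.
  by move=> F _; rewrite addNr.
- by rewrite -scalar_mxM mulrC mm.
- by move=> i j; rewrite -scalar_mxM mm !mxE !ord1.
Qed.

Lemma line_bundle_glue S T : val T \subset val S ->
  forall v, sect1 T v <-> span_over T (sect1 S) v.
Proof.
move=> sTS v; split=> [cv|[s [Ps ->]]]; last first.
  rewrite /sect1 summxE; apply: div_sections_sum => p ps; rewrite mxE.
  have [cp1 [t [Pt ->]]] := Ps p ps; apply: (div_sectionsM (c := fun=> 0) (d := c)) cp1 _ => [F _|].
    by rewrite add0r.
  exists t; split=> // q qt; have [q0 qF] := Pt q qt; split=> // F FT.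
  by apply: qF; exact: (subsetP sTS).
have [m [m0 mF]] := chart_equation S c.
have mm : character m * character (- m) = 1 by rewrite -characterD addrN character0.
exists [:: (character m * v 0 0, (character (- m))%:M)]; split; last first.
  rewrite big_seq1 /=; apply/rowP => j; rewrite !mxE [j]ord1 mulr1n.
  by rewrite mulrAC mm mul1r.
move=> _ /[1!inE] /eqP->; split=> /=.
  apply: (div_sectionsM (c := fun F => - c F) (d := c)) _ cv; last first.
    apply: div_sections_char => // F FT.
    by rewrite mF ?opprK //; exact: (subsetP sTS).
  by move=> F _; rewrite addNr.
rewrite /sect1 mxE mulr1n; apply: div_sections_char => [|F FS].
  by under eq_bigr do rewrite ffunE; rewrite sumrN m0 oppr0.
by under eq_bigr do rewrite ffunE; rewrite sumrN mF.
Qed.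

(* O(sum_F c_F D_F) *)
Definition line_bundle : bundle 1 := Bundle line_bundle_proj line_bundle_glue.

End LineBundle.

(* The first Chern class of L is l; the class of D_F in A^1(X_M) is x_F.      *)
Definition has_c1 (L : bundle 1) (l : chow M int) : Prop :=
  exists2 c, isom_bundle L (line_bundle c) & l = \sum_F x_ F *~ c F.

Definition inverse_bundle (L L' : bundle 1) : Prop :=
  exists2 T : bundle (1 * 1), is_tensor L L' T & isom_bundle T (line_bundle (fun=> 0)).

Definition any_bundle : Type := {n : nat & bundle n}.
HB.instance Definition _ := gen_eqMixin any_bundle.
HB.instance Definition _ := gen_choiceMixin any_bundle.

(* The free commutative ring on vector bundles. The variables are locked to   *)
(* keep unification from unfolding the monoid algebra.                        *)
Definition bundle_poly : comNzRingType :=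
  monalg.malg (monalg.cmonom any_bundle) int.

Definition bundle_var n (V : bundle n) : bundle_poly :=
  locked (monalg.mkmalgU (monalg.ucm (existT _ n V : any_bundle)) 1).

(* The Grothendieck ring, by generators and relations: additive on short      *)
(* exact sequences, with product the tensor product and unit the structure    *)
(* sheaf.                                                                     *)
Inductive K_rel : bundle_poly -> Prop :=
| KExact n p q (V : bundle n) (W : bundle p) (Z : bundle q) of short_exact V W Z :
    K_rel (bundle_var W - (bundle_var V + bundle_var Z))
| KTensor n p (V : bundle n) (W : bundle p) (Z : bundle (n * p)) of is_tensor V W Z :
    K_rel (bundle_var V * bundle_var W - bundle_var Z)
| KUnit : K_rel (bundle_var (line_bundle (fun=> 0)) - 1).

Definition K_ring : Type := quot_ring K_rel.
HB.instance Definition _ := GRing.ComPzRing.on K_ring.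
HB.instance Definition _ := EqQuotient.on K_ring.

Definition K_class n (V : bundle n) : K_ring := quot_pi K_rel (bundle_var V).

(* A^i(M) = 0 for i >= rank M, so the sum is 1 + alpha_F + alpha_F^2 + ...    *)
Definition is_zeta (zeta : {rmorphism K_ring -> chow M int}) : Prop :=
  bijective zeta /\
  forall (F : {set E}) (L : bundle 1), flat M F -> F != set0 ->
    has_c1 L (alpha_ M F) ->
    zeta (K_class L) = \sum_(i < rank M) alpha_ M F ^+ i.

(* With L' inverse to L, zeta (K_class L') is zeta_M(-[L]). *)
Definition calP (R : numDomainType) (zeta : {rmorphism K_ring -> chow M int})
    (l : chow M int) : Prop :=
  chow_deg 1 l /\
  forall L L' : bundle 1, has_c1 L l -> inverse_bundle L L' ->
    forall i, (i < rank M)%N ->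
      nef_cone R i ((-1) ^+ i * chow_part i (zeta (K_class L'))).

End Toric.

(* Main.v *)
Require Import Defs.
From mathcomp Require Import all_boot all_order all_algebra.
From mathcomp Require Import ring zify boolp ssrcomplements mpoly.

Set Implicit Arguments.
Unset Strict Implicit.
Unset Printing Implicit Defensive.

Import Order.TTheory GRing.Theory Num.Theory.
Local Open Scope ring_scope.

(** In rank 3 the proper flats are points (rank 1) and lines (rank 2), two points
    spanning exactly one line, and [X_M] is a surface that looks numerically
    like a blow-up of the plane: [A^1] is spanned by the orthogonal classes
    [alpha] and [x_L] ([L] a line) with [alpha^2 = 1] and [x_L^2 = -1], and
    [x_p] is [alpha] minus the sum of the [x_L] with [L] through the point [p]
    ([deg_h2], [h_line], [deg_lineline], [x_pointE]). Equivalently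
    [alpha_p = 0], while [alpha_L = alpha - x_L] has square zero.

    Put [kappa = alpha - sum_L x_L]. The class of the line bundle of [l] under
    [zeta] is [1 + l + q] with [2 deg q = deg (l^2 + l kappa)]: both sides are
    compatible with sums and inverses, since [A^3 = 0], and they agree on
    [alpha] and on the [alpha_L], which generate [A^1] ([Z_rr_class]). That
    [zeta] depends on [l] only, not on the divisor that represents it, is the
    case of [alpha_p = 0] ([Z_class_eq]). Hence the class of the inverse bundle
    is [1 - l + q'] with [2 deg q' = deg l^2 - deg (l kappa)].

    Let [l] be combinatorially nef. The expressions of [l] adapted to the flags
    with at most one member give [deg (l x_F) >= 0] and [deg l^2 >= 0]. With
    [d = deg (l alpha)] and [e_L = deg (l x_L) >= 0], the orthogonal basis gives
    [deg l^2 = d^2 - sum_L e_L^2], whereas [deg (l kappa) = d - sum_L e_L]. If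
    [d <= sum_L e_L], the latter is at most [0 <= deg l^2]; otherwise
    [sum_L e_L (e_L - 1) <= d (d - 1)] by superadditivity of [n (n - 1)]. In
    both cases [deg q' >= 0] ([deg_kappa_le]), so [q'] is a nonnegative multiple
    of [alpha^2], a product of nef divisors. Conversely the part of degree one
    of the defining condition of [P] says that [l] is a nonnegative combination
    of nef divisors, and these form a convex cone ([nef_cone1]). *)

(** * Rank and flats of a matroid *)

Section MatroidRank.
Variables (E : finType) (M : matroid E).
Implicit Types A B F G I J : {set E}.

Lemma indep_rk A I : I \in indep M -> I \subset A -> (#|I| <= rk M A)%N.
Proof.
move=> iI sIA; pose P J := (J \in indep M) && (J \subset A).
by apply: (@leq_bigmax_cond _ P (fun J : {set E} => #|J|)); rewrite /P iI.
Qed.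

Lemma rk_basis A : exists I, [/\ I \in indep M, I \subset A & #|I| = rk M A].
Proof.
pose P J := (J \in indep M) && (J \subset A).
have P0 : (0 < #|P|)%N.
  by apply/card_gt0P; exists set0; rewrite unfold_in /P indep0 sub0set.
have [I /andP[iI sIA] defrk] := @eq_bigmax_cond _ P (fun J : {set E} => #|J|) P0.
by exists I; split=> //; rewrite /rk -defrk.
Qed.

Lemma rkS A B : A \subset B -> (rk M A <= rk M B)%N.
Proof.
move=> sAB; have [I [iI sIA <-]] := rk_basis A.
by apply: indep_rk => //; apply: subset_trans sAB.
Qed.

Lemma rkU1 e A : (rk M (e |: A) <= (rk M A).+1)%N.
Proof.
have [I [iI sI <-]] := rk_basis (e |: A).
have: (#|I :\ e| <= rk M A)%N.
  apply: indep_rk; first by apply: indepS iI _; rewrite subD1set.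
  by apply/subsetP => f /setD1P[nfe fI]; have /setU1P[/eqP|//] := subsetP sI f fI; rewrite (negPf nfe).
by rewrite (cardsD1 e I); case: (e \in I) => /=; rewrite ?add1n ?add0n //; apply: leqW.
Qed.

(** Independent sets extend to bases by repeated augmentation; a maximal one
    between [J] and [A] is a basis since otherwise a basis of [A] augments it. *)
Lemma indep_extend J A : J \in indep M -> J \subset A ->
  exists I, [/\ I \in indep M, J \subset I, I \subset A & #|I| = rk M A].
Proof.
move=> iJ sJA.
pose P I := [&& I \in indep M, J \subset I & I \subset A].
have PJ : P J by rewrite /P iJ subxx sJA.
have [I /and3P[iI sJI sIA] maxI] := @arg_maxnP _ J P (fun I => #|I|) PJ.
exists I; split=> //; apply/eqP; rewrite eqn_leq indep_rk //= leqNgt; apply/negP => lt.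
have [B [iB sBA cB]] := rk_basis A.
have [|e /setDP[eB neI] ie] := indep_aug iI iB; first by rewrite cB.
have: P (e |: I).
  rewrite /P ie (subset_trans sJI) ?subsetUr //= subUset sub1set sIA andbT.
  exact: subsetP eB.
by move/maxI; rewrite /= cardsU1 neI add1n ltnn.
Qed.

(** Flats are closed sets: a set of the same rank as a subset [A] lies in the
    closure of [A], hence in every flat that contains [A]. *)
Lemma flat_closure A F G : flat M G -> A \subset F -> A \subset G ->
  rk M F = rk M A -> F \subset G.
Proof.
move=> /forall_inP flG sAF sAG rF; apply/subsetP => e eF; apply/negPn/negP => neG.
have [J [iJ sJA cJ]] := rk_basis A.
have [I [iI sJI sIG cI]] := indep_extend iJ (subset_trans sJA sAG).
have lt : (rk M G < rk M (e |: G))%N by apply: flG; rewrite inE.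
have [B [iB sB cB]] := rk_basis (e |: G).
have [|f /setDP[fB nfI] ifI] := indep_aug iI iB; first by rewrite cB cI.
have /setU1P[Ef|fG] := subsetP sB f fB; last first.
  have: (#|f |: I| <= rk M G)%N by apply: indep_rk; rewrite // subUset sub1set fG.
  by rewrite cardsU1 nfI cI add1n ltnn.
have: (#|e |: J| <= rk M F)%N.
  apply: indep_rk; first by apply: indepS ifI _; rewrite Ef setUS.
  by rewrite subUset sub1set eF (subset_trans sJA).
rewrite cardsU1 rF cJ; have -> : e \notin J by rewrite -Ef; apply: contra nfI; apply: subsetP.
by rewrite add1n ltnn.
Qed.

Lemma flat_rk_proper F G : flat M F -> F \proper G -> (rk M F < rk M G)%N.
Proof.
move=> /forall_inP flF /properP[sFG [e eG neF]].
apply: (@leq_trans (rk M (e |: F))); first by apply: flF; rewrite inE.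
by apply: rkS; rewrite subUset sub1set eG.
Qed.

Lemma flat_sub_eq F G : flat M F -> F \subset G -> rk M G = rk M F -> F = G.
Proof.
move=> flF sFG rG; apply/eqP; rewrite eqEproper sFG /=; apply/negP => /(flat_rk_proper flF).
by rewrite rG ltnn.
Qed.

(** The closure of [A], obtained as a largest set of the same rank. *)
Lemma flat_exists A : exists F, [/\ flat M F, A \subset F & rk M F = rk M A].
Proof.
pose P F := (A \subset F) && (rk M F == rk M A).
have PA : P A by rewrite /P subxx eqxx.
have [F /andP[sAF /eqP rF] maxF] := @arg_maxnP _ A P (fun F => #|F|) PA.
exists F; split=> //; apply/forall_inP => e; rewrite inE => neF.
rewrite ltn_neqAle rkS ?subsetUr // andbT; apply/eqP => re.
have: P (e |: F) by rewrite /P -re rF eqxx (subset_trans sAF) ?subsetUr.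
by move/maxF; rewrite /= cardsU1 neF add1n ltnn.
Qed.

End MatroidRank.

(** * Points and lines of a matroid of rank 3 *)

Section RankThree.
Variables (E : finType) (M : matroid E).
Hypotheses (loopM : loopless M) (rk3 : rank M = 3%N).
Implicit Types (p L F G : pflat M).

Lemma pflat_flat (F : pflat M) : flat M (val F).
Proof. by have /and3P[] := valP F. Qed.

Lemma pflat_notin (F : pflat M) : exists i, i \notin val F.
Proof.
have /and3P[_ _ ntF] := valP F.
have /subsetPn[i _ iF] : ~~ ([set: E] \subset val F) by rewrite subTset.
by exists i.
Qed.

Definition point p := rk M (val p) == 1%N.

Lemma rk1 i : rk M [set i] = 1%N.
Proof.
apply/eqP; rewrite eqn_leq; apply/andP; split.
  by have [I [_ /subset_leq_card sI <-]] := rk_basis M [set i]; rewrite (leq_trans sI) ?cards1.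
by rewrite -(cards1 i); apply: indep_rk => //; move/forallP: loopM.
Qed.

(** A nonempty set has positive rank as there are no loops, and a flat other
    than [E] has rank less than 3: proper flats that are not points are lines,
    of rank 2. *)
Lemma pflat_rk (F : pflat M) : rk M (val F) = (~~ point F).+1.
Proof.
have /and3P[flF /set0Pn[i iF] ntF] := valP F.
have ge1 : (1 <= rk M (val F))%N by rewrite -(rk1 i) rkS // sub1set.
have lt3 : (rk M (val F) < 3)%N.
  by rewrite -rk3 /rank flat_rk_proper // properE subsetT subTset.
by rewrite /point; case: (rk M _) ge1 lt3 => [|[|[|]]].
Qed.

Lemma line_rk L : ~~ point L -> rk M (val L) = 2%N.
Proof. by move=> nL; rewrite pflat_rk nL. Qed.

Lemma pflat_of_rk (F : {set E}) n : flat M F -> rk M F = n.+1 -> (n < 2)%N ->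
  proper_flat M F.
Proof.
move=> flF rF n2; rewrite /proper_flat flF /=; apply/andP; split; apply/eqP => DF.
  have [I [_ /subset_leq_card sI cI]] := rk_basis M F.
  by move: sI; rewrite cI rF DF cards0.
by move: rk3; rewrite /rank -DF rF => -[] nE; rewrite nE in n2.
Qed.

Lemma point_of i : {p : pflat M | point p & i \in val p}.
Proof.
apply: sig2W; have [F [flF sF]] := flat_exists M [set i]; rewrite rk1 => rF.
by exists (exist _ F (pflat_of_rk flF rF isT)); rewrite ?/point /= ?rF // -sub1set.
Qed.

(** A point is the closure of each of its elements. *)
Lemma point_sub i p F : point p -> i \in val p -> i \in val F ->
  val p \subset val F.
Proof.
move=> /eqP rp ip iF; apply: (flat_closure (A := [set i])) => //.
- exact: pflat_flat.
- by rewrite sub1set.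
- by rewrite sub1set.
- by rewrite rp rk1.
Qed.

Lemma point_inj i p p' : point p -> point p' -> i \in val p -> i \in val p' -> p = p'.
Proof.
move=> pp pp' ip ip'; apply: val_inj; apply/eqP; rewrite eqEsubset.
by rewrite !(point_sub (i := i)).
Qed.

Lemma rk_join i p : point p -> i \notin val p -> rk M (i |: val p) = 2%N.
Proof.
move=> /eqP rp nip; apply/eqP; rewrite eqn_leq; apply/andP; split.
  by rewrite (leq_trans (rkU1 _ _ _)) // rp.
by rewrite -rp flat_rk_proper ?pflat_flat // properUr // sub1set.
Qed.

Lemma line_through i p : point p -> i \notin val p ->
  {L : pflat M | ~~ point L & (i \in val L) && (val p \subset val L)}.
Proof.
move=> pp nip; apply: sig2W.
have [F [flF]] := flat_exists M (i |: val p); rewrite rk_join // subUset sub1set => sF rF.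
by exists (exist _ F (pflat_of_rk flF rF isT)); rewrite // /point /= rF.
Qed.

Lemma line_inj i p L L' : point p -> i \notin val p -> ~~ point L -> ~~ point L' ->
  i \in val L -> i \in val L' -> val p \subset val L -> val p \subset val L' -> L = L'.
Proof.
move=> pp nip nL nL' iL iL' pL pL'; apply: val_inj; apply: (flat_sub_eq (M := M)).
- exact: pflat_flat.
- apply: (flat_closure (A := i |: val p)).
  + exact: pflat_flat.
  + by rewrite subUset sub1set iL.
  + by rewrite subUset sub1set iL'.
  + by rewrite line_rk ?rk_join.
- by rewrite !line_rk.
Qed.

Lemma subset_rk (F G : pflat M) : val F \subset val G -> point F = point G -> F = G.
Proof.
move=> sFG eFG; apply: val_inj; apply: (flat_sub_eq (M := M)) => //.
  exact: pflat_flat.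
by rewrite !(pflat_rk) eFG.
Qed.

Lemma subset_line_point p L : ~~ point L -> point p -> ~~ (val L \subset val p).
Proof.
move=> nL /eqP rp; apply/negP => /(rkS M); rewrite line_rk // rp.
by [].
Qed.

Lemma comparable_same (F G : pflat M) : point F = point G ->
  Defs.comparable (val F) (val G) = (F == G).
Proof.
move=> eFG; apply/idP/eqP => [/orP[] s|->]; last by rewrite /Defs.comparable subxx.
  exact: subset_rk.
by apply/esym/subset_rk.
Qed.

Lemma comparable_point_line p L : point p -> ~~ point L ->
  Defs.comparable (val p) (val L) = (val p \subset val L).
Proof.
by move=> pp nL; rewrite /Defs.comparable (negPf (subset_line_point nL pp)) orbF.
Qed.

End RankThree.

(** * Ideals and gradings of the Chow ring *)

Section IdealMap.
Variables (R S : comPzRingType) (G : R -> Prop) (H : S -> Prop).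

Lemma ideal_gen_map (f : {rmorphism R -> S}) x :
  (forall g, G g -> H (f g)) -> ideal_gen G x -> ideal_gen H (f x).
Proof.
move=> fG [s [Gs ->]]; exists [seq (f p.1, f p.2) | p <- s]; split.
  by move=> _ /mapP[p /Gs Gp ->]; apply: fG.
by rewrite rmorph_sum big_map; apply: eq_bigr => p _; rewrite rmorphM.
Qed.

End IdealMap.

Section Homogeneous.
Variables (n : nat) (R : comNzRingType) (G : {mpoly R[n]} -> Prop).

(** Every element of the ideal is a sum of scaled monomial multiples of the
    generators, so additive properties need only be checked on these. *)
Lemma ideal_gen_monomials (P : {mpoly R[n]} -> Prop) :
  P 0 -> (forall p q, P p -> P q -> P (p + q)) ->
  (forall c m g, G g -> P (c *: ('X_[m] * g))) ->
  forall p, ideal_gen G p -> P p.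
Proof.
move=> P0 PD PX p [s [Gs ->]]; rewrite big_seq; apply: big_ind => // q /Gs Gq.
rewrite [q.1]mpolyE big_distrl; apply: big_ind => //= m _.
by rewrite -scalerAl; apply: PX.
Qed.

(** The projection to a degree sends a monomial multiple of a homogeneous
    generator to itself or to zero. *)
Lemma ideal_gen_pihomog : (forall g, G g -> exists d, g \is d.-homog) ->
  forall i p, ideal_gen G p -> ideal_gen G (pihomog mdeg i p).
Proof.
move=> homG i; apply: ideal_gen_monomials => [|p q|c m g Gg].
- by rewrite linear0; exists [::]; rewrite big_nil.
- by rewrite linearD; apply: ideal_gen_add.
rewrite linearZ /= -mul_mpolyC; apply: ideal_gen_mul.
have [d homg] := homG g Gg.
have homXg : 'X_[m] * g \is (mdeg m + d).-homog.
  by apply: dhomogM; rewrite // dhomogX.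
have [<-|ne] := eqVneq (mdeg m + d)%N i; last first.
  by rewrite (pihomog_ne0 ne homXg); exists [::]; rewrite big_nil.
by rewrite pihomog_dE //; apply: ideal_gen_mul; exists [:: (1, g)];
  rewrite big_seq1 mul1r; split=> // p /[1!inE] /eqP->.
Qed.

End Homogeneous.

Section ChowGeneral.
Variables (E : finType) (M : matroid E).
Implicit Types (F G : pflat M).

Section Coef.
Variable R : comNzRingType.

Lemma chow_var_homog F : chow_var R F \is 1.-homog.
Proof. by rewrite dhomogX /= mdeg1. Qed.

Lemma chow_rel_homog (g : {mpoly R[#|{: pflat M}|]}) :
  chow_rel g -> exists d, g \is d.-homog.
Proof.
case=> [F G _|i j]; first by exists (1 + 1)%N; exact: (dhomogM (chow_var_homog F) (chow_var_homog G)).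
by exists 1%N; apply: rpredB; apply: rpred_sum => F _; exact: chow_var_homog.
Qed.

Lemma chow_class_eq (p q : {mpoly R[#|{: pflat M}|]}) :
  chow_class p = chow_class q <-> ideal_gen (@chow_rel _ M R) (p - q).
Proof.
split=> [/eqP|]; first by move/quot_piP.
by move/quot_piP/eqP.
Qed.

Lemma chow_classK (a : chow M R) : chow_class (repr a) = a.
Proof. exact: quot_piK. Qed.

Lemma chow_classP (a : chow M R) : exists p, a = chow_class p.
Proof. by exists (repr a); rewrite chow_classK. Qed.

Lemma chow_class_rel (p : {mpoly R[#|{: pflat M}|]}) : chow_rel p -> chow_class p = 0.
Proof. by move/(@quot_pi_gen _ (@chow_rel _ M R)); rewrite rmorph0. Qed.

Lemma chow_part_class i (p : {mpoly R[#|{: pflat M}|]}) :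
  chow_part i (chow_class p) = chow_class (pihomog mdeg i p).
Proof.
apply/chow_class_eq; rewrite -raddfB; apply: ideal_gen_pihomog; first exact: chow_rel_homog.
by apply/chow_class_eq; rewrite chow_classK.
Qed.

Lemma chow_partD i (a b : chow M R) : chow_part i (a + b) = chow_part i a + chow_part i b.
Proof.
have [p ->] := chow_classP a; have [q ->] := chow_classP b.
by rewrite -rmorphD !chow_part_class -rmorphD raddfD.
Qed.

Lemma chow_part_deg i j (a : chow M R) : chow_deg i a ->
  chow_part j a = if i == j then a else 0.
Proof.
case=> p homp ->; rewrite chow_part_class.
case: eqVneq => [<-|ne]; first by rewrite pihomog_dE.
by rewrite (pihomog_ne0 ne homp) rmorph0.
Qed.

Lemma chow_deg0 i : chow_deg i (0 : chow M R).
Proof. by exists 0; rewrite ?rpred0 ?rmorph0. Qed.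

Lemma chow_deg1 : chow_deg 0 (1 : chow M R).
Proof. by exists 1; rewrite ?rmorph1 ?dhomog1. Qed.

Lemma chow_degD i (a b : chow M R) : chow_deg i a -> chow_deg i b -> chow_deg i (a + b).
Proof.
by move=> [p hp ->] [q hq ->]; exists (p + q); rewrite ?rmorphD ?rpredD.
Qed.

Lemma chow_degN i (a : chow M R) : chow_deg i a -> chow_deg i (- a).
Proof. by move=> [p hp ->]; exists (- p); rewrite ?rmorphN ?rpredN. Qed.

Lemma chow_degB i (a b : chow M R) : chow_deg i a -> chow_deg i b -> chow_deg i (a - b).
Proof. by move=> da db; apply/chow_degD/chow_degN. Qed.

Lemma chow_degM i j (a b : chow M R) :
  chow_deg i a -> chow_deg j b -> chow_deg (i + j) (a * b).
Proof.
by move=> [p hp ->] [q hq ->]; exists (p * q); rewrite ?rmorphM // dhomogM.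
Qed.

Lemma chow_deg_sum i (I : Type) (r : seq I) (P : pred I) (f : I -> chow M R) :
  (forall j, P j -> chow_deg i (f j)) -> chow_deg i (\sum_(j <- r | P j) f j).
Proof.
move=> df; apply: big_ind => //; [exact: chow_deg0 | exact: chow_degD].
Qed.

End Coef.

Lemma chow_degMz i (a : chow M int) n : chow_deg i a -> chow_deg i (a *~ n).
Proof.
move=> [p hp ->]; exists (p *~ n); last by rewrite raddfMz.
by case: n => n; rewrite ?NegzE ?mulrNz -!pmulrn ?rpredN rpredMn.
Qed.

Lemma x_deg1 F : chow_deg 1 (x_ F).
Proof. by exists (chow_var int F); rewrite // chow_var_homog. Qed.

(** The monomials of degree one are the variables. *)
Lemma chow_deg1E (l : chow M int) : chow_deg 1 l <-> exists c, l = \sum_F x_ F *~ c F.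
Proof.
split=> [[p homp ->]|[c ->]]; last first.
  by apply: chow_deg_sum => F _; apply/chow_degMz/x_deg1.
exists (fun F => p@_(U_(enum_rank F))).
have Dp : p = \sum_F chow_var int F *~ p@_(U_(enum_rank F)).
  apply/mpolyP => m; rewrite raddf_sum /=.
  under eq_bigr do rewrite raddfMz /= mcoeffX.
  have [/eqP/mdeg1P[j /eqP->]|ne] := eqVneq (mdeg m) 1%N; last first.
    rewrite (dhomog_nemf_coeff homp ne) big1 // => F _.
    by case: eqP => [Dm|]; rewrite ?mul0rz //; rewrite -Dm mdeg1 in ne.
  rewrite (bigD1 (enum_val j)) //= enum_valK eqxx -[LHS]addr0; congr (_ + _); first by rewrite intz.
  rewrite big1 // => F neF; case: eqP => [/eqP|]; rewrite ?mul0rz //.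
  rewrite eq_mnm1 => /eqP DF; by rewrite -DF enum_rankK eqxx in neF.
by rewrite {1}Dp rmorph_sum /=; apply: eq_bigr => F _; rewrite raddfMz.
Qed.

Section Ext.
Variable R : comNzRingType.

Lemma map_chow_var F : map_mpoly intr (chow_var int F) = chow_var R F.
Proof. by rewrite map_mpolyX. Qed.

Lemma map_chow_sum i :
  map_mpoly intr (\sum_(F : pflat M | i \in val F) chow_var int F)
    = \sum_(F : pflat M | i \in val F) chow_var R F.
Proof. by rewrite raddf_sum; apply: eq_bigr => F _; exact: map_chow_var. Qed.

Lemma chow_rel_map g : chow_rel g -> chow_rel (map_mpoly intr g : {mpoly R[#|{: pflat M}|]}).
Proof.
case=> [F G ncFG|i j].
  by rewrite rmorphM /= !map_chow_var; apply: ChowIncomparable.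
rewrite raddfB /= !map_chow_sum.
exact: ChowLinear.
Qed.

Lemma chow_ext_class (p : {mpoly int[#|{: pflat M}|]}) :
  chow_ext R (chow_class p) = chow_class (map_mpoly intr p).
Proof.
apply/chow_class_eq; rewrite -raddfB.
apply: (ideal_gen_map (f := map_mpoly intr)) => [g|]; first exact: chow_rel_map.
by apply/chow_class_eq; rewrite chow_classK.
Qed.

Lemma chow_extD : {morph @chow_ext _ M R : a b / a + b}.
Proof.
move=> a b; have [p ->] := chow_classP a; have [q ->] := chow_classP b.
by rewrite -rmorphD !chow_ext_class !rmorphD.
Qed.

Lemma chow_extMz (a : chow M int) (n : int) :
  chow_ext R (a *~ n) = chow_class n%:~R%:MP * chow_ext R a.
Proof.
have [p ->] := chow_classP a.
have Dn : map_mpoly intr (p *~ n) = n%:~R%:MP * map_mpoly intr p :> {mpoly R[_]}.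
  by rewrite raddfMz mul_mpolyC scaler_int.
by rewrite -raddfMz !chow_ext_class Dn rmorphM.
Qed.

Lemma chow_ext_x F : chow_ext R (x_ F) = chow_class (chow_var R F).
Proof. by rewrite chow_ext_class map_chow_var. Qed.

Lemma chow_ext0 : chow_ext R (0 : chow M int) = 0.
Proof. by rewrite -(rmorph0 (@chow_class _ M int)) chow_ext_class !rmorph0. Qed.

End Ext.

Lemma chow_ext_int (a : chow M int) : chow_ext int a = a.
Proof.
have [p ->] := chow_classP a; rewrite chow_ext_class; congr chow_class.
by apply/mpolyP => m; rewrite mcoeff_map_mpoly /= intz.
Qed.

End ChowGeneral.

(** * The degree with rational coefficients *)

Section MonomialExtension.
Variables (n : nat) (R : comNzRingType) (w : 'X_{1..n} -> R).

Definition mpoly_lin (p : {mpoly R[n]}) : R := \sum_(m <- msupp p) p@_m * w m.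

Lemma mpoly_linwE k p : (msize p <= k)%N ->
  mpoly_lin p = \sum_(m : 'X_{1..n < k}) p@_m * w m.
Proof.
move=> lt_pk; pose I : subFinType _ := 'X_{1..n < k}.
rewrite /mpoly_lin (big_mksub I) /=; first last.
- by move=> x /msize_mdeg_lt /leq_trans /(_ lt_pk) ->.
- by rewrite msupp_uniq.
by rewrite big_rmcond //= => m /memN_msupp_eq0 ->; rewrite mul0r.
Qed.

Lemma mpoly_linP c p q : mpoly_lin (c *: p + q) = c * mpoly_lin p + mpoly_lin q.
Proof.
set k := maxn (msize (c *: p + q)) (maxn (msize p) (msize q)).
rewrite !(@mpoly_linwE k) ?leq_max ?leqnn ?orbT //.
rewrite mulr_sumr -big_split; apply: eq_bigr => m _ /=.
by rewrite linearP /= mulrDl mulrA.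
Qed.

Lemma mpoly_lin0 : mpoly_lin 0 = 0.
Proof. by rewrite /mpoly_lin msupp0 big_nil. Qed.

Lemma mpoly_linZ c p : mpoly_lin (c *: p) = c * mpoly_lin p.
Proof. by rewrite -[c *: p]addr0 mpoly_linP mpoly_lin0 addr0. Qed.

Lemma mpoly_linD p q : mpoly_lin (p + q) = mpoly_lin p + mpoly_lin q.
Proof. by rewrite -[p in LHS]scale1r mpoly_linP mul1r. Qed.

Lemma mpoly_linX m : mpoly_lin 'X_[m] = w m.
Proof. by rewrite /mpoly_lin msuppX big_seq1 mcoeffX eqxx mul1r. Qed.

Lemma mpoly_lin_sum (I : Type) (r : seq I) (f : I -> {mpoly R[n]}) :
  mpoly_lin (\sum_(i <- r) f i) = \sum_(i <- r) mpoly_lin (f i).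
Proof. exact: (big_morph _ mpoly_linD mpoly_lin0). Qed.

End MonomialExtension.

Section RationalDegree.
Variables (E : finType) (M : matroid E) (deg : {additive chow M int -> int}).

(** Defined on monomials by the integral degree, this vanishes on the rational
    ideal of relations because the relations have integral coefficients. *)
Let degQ : {mpoly rat[#|{: pflat M}|]} -> rat :=
  mpoly_lin (fun m => (deg (chow_class 'X_[m]))%:~R).

Lemma degQ_map p : degQ (map_mpoly intr p) = (deg (chow_class p))%:~R.
Proof.
have -> : map_mpoly intr p = \sum_(m <- msupp p) (p@_m)%:~R *: 'X_[m] :> {mpoly rat[_]}.
  rewrite {1}[p]mpolyE raddf_sum; apply: eq_bigr => m _.
  by rewrite /= map_mpolyZ map_mpolyX.
rewrite /degQ mpoly_lin_sum [in RHS](mpolyE p) !raddf_sum; apply: eq_bigr => m _.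
rewrite mpoly_linZ mpoly_linX -[p@_m in RHS]intz scaler_int /= !raddfMz /=.
by rewrite mulrzl.
Qed.

Lemma degQ_ideal p : ideal_gen (@chow_rel _ M rat) p -> degQ p = 0.
Proof.
apply: (ideal_gen_monomials (P := fun p => degQ p = 0)) => [|q r q0 r0|c m g rel_g].
- exact: mpoly_lin0.

- by rewrite /degQ mpoly_linD [X in X + _]q0 [X in _ + X]r0 addr0.
rewrite /degQ mpoly_linZ -/degQ.
have [g0 rel_g0 ->] : exists2 g0, chow_rel g0 & g = map_mpoly intr g0.
  case: rel_g => [F G ncFG|i j].
    exists (chow_var int F * chow_var int G); first exact: ChowIncomparable.
    by rewrite rmorphM /= !map_chow_var.
  exists (\sum_(F : pflat M | i \in val F) chow_var int F
              - \sum_(F : pflat M | j \in val F) chow_var int F).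
    exact: ChowLinear.
  by rewrite raddfB /= !map_chow_sum.
rewrite -(map_mpolyX (intr : int -> rat)) -rmorphM degQ_map rmorphM /=.
by rewrite (chow_class_rel rel_g0) mulr0 raddf0 mulr0.
Qed.

Lemma degQ_eq p q : ideal_gen (@chow_rel _ M rat) (p - q) -> degQ p = degQ q.
Proof. by move=> /degQ_ideal pq; rewrite -(subrK q p) /degQ mpoly_linD -/degQ pq add0r. Qed.

(** Degrees of integral classes can be computed from rational expressions:
    the degree extends to the Chow ring with rational coefficients. *)
Lemma deg_rat_expr (l m : chow M int) (c : pflat M -> rat) :
  chow_ext rat l = \sum_F chow_class (c F *: chow_var rat F) ->
  (deg (l * m))%:~R = \sum_F c F * (deg (x_ F * m))%:~R.
Proof.
have [p ->] := chow_classP l; have [q ->] := chow_classP m => Dl.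
rewrite -rmorphM -degQ_map rmorphM.
rewrite (@degQ_eq _ ((\sum_F c F *: chow_var rat F) * map_mpoly intr q)); last first.
  rewrite -mulrBl mulrC; apply: ideal_gen_mul; apply/chow_class_eq.
  by rewrite -chow_ext_class Dl rmorph_sum.
rewrite big_distrl /degQ /= mpoly_lin_sum; apply: eq_bigr => F _.
rewrite -scalerAl mpoly_linZ -/degQ; congr (_ * _).
by rewrite -map_chow_var -rmorphM degQ_map rmorphM.
Qed.

End RationalDegree.

(** * Line bundles in the Grothendieck ring *)

Section KRing.
Variables (k : fieldType) (E : finType) (M : matroid E).
Implicit Types (c d : pflat M -> int) (S T : flag M).

Lemma K_rel_eq (p q : bundle_poly k M) : K_rel (p - q) ->
  quot_pi (@K_rel k E M) p = quot_pi (@K_rel k E M) q.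
Proof.
move=> Kpq; apply/eqP/quot_piP; exists [:: (1, p - q)]; rewrite big_seq1 mul1r.
by split=> // r /[1!inE] /eqP->.
Qed.

Let sect0 S (v : 'rV[ratfun k E]_0) : Prop := True.

Lemma bundle0_proj S : exists N (A : 'M[ratfun k E]_(N, 0)) (B : 'M[ratfun k E]_(0, N)),
  [/\ forall v, sect0 S v <->
        exists2 u : 'rV_N, (forall j, coord_ring S (u 0 j)) & v = u *m A,
      B *m A = 1%:M
    & forall i j, coord_ring S ((A *m B) i j)].
Proof.
exists 0%N, 0, 0; split=> [v||[]//]; last by apply/matrixP => -[].
by split=> // _; exists 0 => [[]//|]; apply/rowP => -[].
Qed.

Lemma bundle0_glue S T : val T \subset val S ->
  forall v, sect0 T v <-> span_over T (sect0 S) v.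
Proof.
move=> _ v; split=> // _; exists [::]; split=> //.
by rewrite big_nil; apply/rowP => -[].
Qed.

Definition bundle0 : bundle k M 0 := Bundle bundle0_proj bundle0_glue.

(** The zero bundle makes isomorphisms into short exact sequences. *)
Lemma K_bundle0 : K_class bundle0 = 0.
Proof.
have : K_class bundle0 = K_class bundle0 + K_class bundle0.
  rewrite /K_class -[RHS]rmorphD; apply/K_rel_eq/KExact; exists 0, 0 => S; split=> //.
  - by move=> u _; split=> // _; apply/rowP => -[].
  - move=> w _; split=> [_|_]; last by apply/rowP => -[].
    by exists 0 => //; apply/rowP => -[].
  - by move=> z; split=> // _; exists 0 => //; apply/rowP => -[].
by move=> /(congr1 (fun x => x - K_class bundle0)); rewrite addrK subrr.
Qed.

Lemma K_isom n (V W : bundle k M n) : isom_bundle V W -> K_class V = K_class W.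
Proof.
case=> g gU VW; suff DW: K_class W = K_class V + K_class bundle0.
  by apply: esym; rewrite DW K_bundle0 addr0.
rewrite /K_class -[RHS]rmorphD; apply/K_rel_eq/KExact; exists g, 0 => S; split.
- move=> u Vu; split; first exact/VW.
  by move/(congr1 (mulmx^~ (invmx g))); rewrite mulmxK // mul0mx.
- move=> w Ww; split=> [_|_]; last by apply/rowP => -[].
  by exists (w *m invmx g); [apply/VW|]; rewrite mulmxKV.
- move=> z; split=> // _; exists 0; last by apply/rowP => -[].
  have [N [A [B [WA _ _]]]] := sect_proj W S.
  apply/WA; exists 0; rewrite ?mul0mx // => j.
  by rewrite mxE; exists [::]; rewrite big_nil.
Qed.

Lemma isom_refl n (V : bundle k M n) : isom_bundle V V.
Proof. by exists 1%:M; [exact: unitmx1 | move=> S v; rewrite mulmx1]. Qed.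

Lemma has_c1_line c : has_c1 (line_bundle k c) (\sum_F x_ F *~ c F).
Proof. by exists c => //; apply: isom_refl. Qed.

Lemma tensor_line_entry (R : comNzRingType) (v w : 'rV[R]_1) :
  mxvec (v^T *m w) 0 0 = v 0 0 * w 0 0.
Proof.
transitivity (mxvec (v^T *m w) 0 (mxvec_index 0 0)).
  by congr (mxvec (v^T *m w) 0 _); exact: (esym (@ord1 (mxvec_index (0 : 'I_1) (0 : 'I_1)))).
by rewrite mxvecE mxE big_ord1 mxE.
Qed.

(** On each chart the first divisor is principal, so a section for the sum of
    the divisors is the product of a generator for the first and a section for
    the second. *)
Lemma line_tensor c d :
  is_tensor (line_bundle k c) (line_bundle k d)
    (line_bundle k (fun F => c F + d F) : bundle k M (1 * 1)).
Proof.
move=> S z; split=> [zS|[s [Ps ->]]]; last first.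
  rewrite /= summxE; apply: div_sections_sum => p ps; rewrite mxE.
  have [cp [v [w [Vv Ww ->]]]] := Ps p ps.
  apply: (div_sectionsM (c := fun=> 0) (d := fun F => c F + d F)) cp _ => [F _|].
    by rewrite add0r.
  rewrite tensor_line_entry.
  exact: (div_sectionsM _ Vv Ww).
have [m [m0 mF]] := chart_equation S c.
have mm : character k (- m) * character k m = 1 by rewrite -characterD addNr character0.
have DNm A : \sum_(e in A) (- m) e = - \sum_(e in A) m e.
  by rewrite -sumrN; apply: eq_bigr => e _; rewrite ffunE.
exists [:: (1, z)]; split; last by rewrite big_seq1 scale1r.
move=> _ /[1!inE] /eqP->; split=> /=.
  rewrite -(character0 k E); apply: div_sections_char => [|F _].
    by rewrite big1 // => e _; rewrite ffunE.
  by rewrite big1 // => e _; rewrite ffunE.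
exists (character k (- m))%:M, (character k m * z 0 0)%:M; split.
- rewrite /= mxE mulr1n; apply: div_sections_char => [|F FS].
    by under eq_bigr do rewrite ffunE; rewrite sumrN m0 oppr0.
  by rewrite DNm mF.
- rewrite /= mxE mulr1n.
  apply: (div_sectionsM (c := fun F => - c F) (d := fun F => c F + d F)) _ zS.
    by move=> F _; rewrite addKr.
  by apply: div_sections_char => // F FS; rewrite mF ?opprK.
- apply/rowP => j; rewrite (ord1 (j : 'I_1)) tensor_line_entry !mxE !mulr1n.
  by rewrite mulrA mm mul1r.
Qed.

Lemma K_line0 : K_class (line_bundle k (fun=> 0 : int) : bundle k M 1) = 1.
Proof. by rewrite -(rmorph1 (quot_pi (@K_rel k E M))); apply/K_rel_eq/KUnit. Qed.

Lemma K_lineD c d : K_class (line_bundle k (fun F => c F + d F)) =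
  K_class (line_bundle k c) * K_class (line_bundle k d).
Proof.
rewrite /K_class -[RHS]rmorphM; apply/esym/K_rel_eq.
exact: (KTensor (line_tensor c d)).
Qed.

Lemma eq_line c d : c =1 d -> line_bundle k c = line_bundle k d.
Proof. by move=> /funext->. Qed.

Lemma K_lineN c : K_class (line_bundle k c) * K_class (line_bundle k (fun F => - c F)) = 1.
Proof. by rewrite -K_lineD -K_line0; congr K_class; apply: eq_line => F; rewrite subrr. Qed.

Lemma K_inverse (L L' : bundle k M 1) : inverse_bundle L L' -> K_class L * K_class L' = 1.
Proof.
case=> T LL'T /K_isom; rewrite K_line0 => <-.
by rewrite /K_class -[LHS]rmorphM; apply/K_rel_eq/KTensor.
Qed.

Lemma inverse_line c : inverse_bundle (line_bundle k c) (line_bundle k (fun F => - c F)).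
Proof.
exists (line_bundle k (fun F => c F + - c F)); first exact: line_tensor.
by rewrite (@eq_line _ (fun=> 0)) => [|F]; [apply: isom_refl | rewrite subrr].
Qed.

End KRing.

(** * The divisor alpha *)

Section AlphaDivisors.
Variables (E : finType) (M : matroid E).
Implicit Types (F G : pflat M).

Lemma alphaE i : alpha M = \sum_(F : pflat M | i \in val F) x_ F.
Proof.
rewrite /alpha; case: pickP => [j _|/(_ i)//].
have := chow_class_rel (@ChowLinear _ M int j i).
by rewrite rmorphB !rmorph_sum => /eqP; rewrite subr_eq0 => /eqP.
Qed.

Lemma alpha_deg1 : chow_deg 1 (alpha M).
Proof.
rewrite /alpha; case: pickP => [j _|_]; last exact: chow_deg0.
by apply: chow_deg_sum => F _; apply: x_deg1.
Qed.

Lemma x_incomparable F G : ~~ Defs.comparable (val F) (val G) -> x_ F * x_ G = 0.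
Proof. by move=> nFG; rewrite /x_ -rmorphM; apply/chow_class_rel/ChowIncomparable. Qed.

(** [alpha] is nef: the element [i] in its expression can be chosen outside
    every flat of a given flag, the largest of them being proper. *)
Lemma comb_nef_alpha : E -> comb_nef (alpha M).
Proof.
move=> i0; split=> [|S]; first exact: alpha_deg1.
have [i iS] : exists i, forall F, F \in val S -> i \notin val F.
  have [S0|[F0 F0S]] := set_0Vmem (val S); first by exists i0 => F; rewrite S0 inE.
  have [F FS maxF] := @arg_maxnP _ F0 (mem (val S)) (fun F => #|val F|) F0S.
  have [i iF] := pflat_notin F; exists i => G GS.
  have /'forall_in_'forall_in_idP/(_ G GS F FS) := valP S.
  case/orP => [/subsetP sGF|sFG]; first by apply: contra iF; apply: sGF.
  suff <- : val F = val G by [].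
  by apply/eqP; rewrite eqEcard sFG; apply: maxF.
exists (fun F => (i \in val F)%:R); split=> [|F FS|F _ _].
- rewrite (alphaE i) big_mkcond (big_morph _ (@chow_extD _ M rat) (@chow_ext0 _ M rat)).
  apply: eq_bigr => F _; case: ifP => _.
    by rewrite scale1r chow_ext_x.
  by rewrite scale0r rmorph0 chow_ext0.
- by rewrite (negPf (iS F FS)).
- exact: ler0n.
Qed.

End AlphaDivisors.

(** * Intersection theory on the surface *)

(** The intersection theory of the surface [X_M] depends only on these features
    of its Chow ring: [x F] is the curve of the flat [F], [h] is [alpha], and
    [ishomog n] singles out the classes of degree [n]. *)
Record surface_ring (E : finType) (M : matroid E) (A : comPzRingType)
    (x : pflat M -> A) (h : A) (ishomog : nat -> A -> Prop) (deg : {additive A -> int}) : Prop :=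
  SurfaceRing {
    surf0 : forall n, ishomog n 0;
    surfD : forall n a b, ishomog n a -> ishomog n b -> ishomog n (a + b);
    surfN : forall n a, ishomog n a -> ishomog n (- a);
    surfM : forall a b, ishomog 1 a -> ishomog 1 b -> ishomog 2 (a * b);
    surfx : forall F, ishomog 1 (x F);
    surf_span : forall a, ishomog 1 a -> exists c, a = \sum_F x F *~ c F;
    surf_h : forall i, h = \sum_(F : pflat M | i \in val F) x F;
    surf_incomparable : forall F G : pflat M,
      ~~ Defs.comparable (val F) (val G) -> x F * x G = 0;
    surf_deg_flag : forall F G : pflat M, point F -> ~~ point G ->
      val F \subset val G -> deg (x F * x G) = 1;
    surf_deg_inj : forall a, ishomog 2 a -> deg a = 0 -> a = 0
  }.

Section Surface.
Variables (E : finType) (M : matroid E).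
Hypotheses (loopM : loopless M) (rk3 : rank M = 3%N).
Variables (A : comPzRingType) (x : pflat M -> A) (h : A) (ishomog : nat -> A -> Prop).
Variable deg : {additive A -> int}.
Hypothesis surfA : surface_ring x h ishomog deg.
Implicit Types (F G p L : pflat M) (l m q : A).

Let x_incomparable := surf_incomparable surfA.
Let deg_point_line := surf_deg_flag surfA.

Lemma ex_elt : E.
Proof using rk3.
suff /sig2W[i] : exists2 i : E, i \in [set: E] & true by [].
suff /set0Pn[i iE] : [set: E] != set0 by exists i.
apply/eqP => E0; have [I [_ /subset_leq_card]] := rk_basis M [set: E].
by rewrite -/(rank M) rk3 E0 cards0 => + cI; rewrite cI.
Qed.


Lemma ishomog_h : ishomog 1 h.
Proof.
rewrite (surf_h surfA ex_elt); apply: big_ind => [||F _]; first exact: (surf0 surfA).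
  exact: (surfD surfA).
exact: (surfx surfA).
Qed.

Lemma ishomogB n a b : ishomog n a -> ishomog n b -> ishomog n (a - b).
Proof. by move=> da db; apply/(surfD surfA)/(surfN surfA). Qed.

Lemma ishomogMz n a (c : int) : ishomog n a -> ishomog n (a *~ c).
Proof.
move=> da; have dMn (j : nat) : ishomog n (a *+ j).
  elim: j => [|j IHj]; rewrite ?mulr0n ?mulrS; first exact: (surf0 surfA).
  exact: (surfD surfA).
by case: c => j; rewrite ?NegzE ?mulrNz -pmulrn //; apply: (surfN surfA).
Qed.

(** The analogue of [alpha_F]. *)
Definition h_ (F : {set E}) : A := h - \sum_(G : pflat M | F \subset val G) x G.

Lemma ishomog_h_ (F : {set E}) : ishomog 1 (h_ F).
Proof.
apply: ishomogB; first exact: ishomog_h.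
apply: big_ind => [||G _]; [exact: (surf0 surfA) | exact: (surfD surfA) | exact: (surfx surfA)].
Qed.

Lemma xx_same F G : point F = point G -> F != G -> x F * x G = 0.
Proof. by move=> eFG neq; apply: x_incomparable; rewrite comparable_same. Qed.

Lemma deg_xx_ge0 F G : F != G -> 0 <= deg (x F * x G).
Proof.
move=> neq; case: (boolP (Defs.comparable (val F) (val G))) => [cFG|/x_incomparable->]; last first.
  by rewrite raddf0.
have [pF|nF] := boolP (point F); have [pG|nG] := boolP (point G).
- by rewrite xx_same ?raddf0 ?pF ?pG.
- by rewrite deg_point_line // -(comparable_point_line loopM rk3).
- rewrite mulrC deg_point_line // -(comparable_point_line loopM rk3) //.
  by rewrite /Defs.comparable orbC.
- by rewrite xx_same ?raddf0 // (negPf nF) (negPf nG).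
Qed.

(** In the expression of [alpha] through an element outside [L], no flat is
    comparable to [L]. *)
Lemma h_line L : ~~ point L -> h * x L = 0.
Proof.
move=> nL; have [i iL] := pflat_notin L; rewrite (surf_h surfA i) big_distrl /=.
apply: big1 => F iF; apply: x_incomparable; apply: contra iL.
have [pF|nF] := boolP (point F).
  by rewrite (comparable_point_line loopM rk3) // => /subsetP; apply.
by rewrite comparable_same ?(negPf nF) ?(negPf nL) // => /eqP<-.
Qed.

(** In the expression of [alpha] through an element outside [p], only the line
    that joins it to [p] is comparable to [p]. *)
Lemma deg_h_point p : point p -> deg (h * x p) = 1.
Proof.
move=> pp; have [i ip] := pflat_notin p.
have [L nL /andP[iL pL]] := line_through rk3 pp ip.
rewrite (surf_h surfA i) big_distrl (bigD1 L) //= raddfD /= mulrC deg_point_line //.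
rewrite big1 ?raddf0 ?addr0 // => F /andP[iF neF]; apply: x_incomparable.
have [pF|nF] := boolP (point F).
  rewrite (comparable_same loopM rk3) ?pF ?pp; last by [].
  by apply: contraNneq ip => <-.
rewrite /Defs.comparable orbC -/(Defs.comparable (val p) (val F)).
rewrite (comparable_point_line loopM rk3) //; apply: contra neF => pF.
by apply/eqP/(line_inj loopM rk3 pp ip).
Qed.

Lemma deg_h2 (i : E) : deg (h * h) = 1.
Proof.
have [p pp ip] := point_of loopM rk3 i.
rewrite {2}(surf_h surfA i) big_distrr (bigD1 p) //= raddfD /= deg_h_point //.
rewrite big1 ?raddf0 ?addr0 // => F /andP[iF neF]; apply: h_line.
by apply: contra neF => pF; apply/eqP/(point_inj loopM pF pp iF ip).
Qed.

(** In the expression of [alpha] through an element of [L], only [L] and the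
    point of that element are comparable to [L], and [alpha x_L = 0]. *)
Lemma deg_lineline L : ~~ point L -> deg (x L * x L) = -1.
Proof.
move=> nL; have /and3P[_ /set0Pn[i iL] _] := valP L.
have [p pp ip] := point_of loopM rk3 i.
have neq : p != L by apply: contraTneq pp => ->.
have: deg (h * x L) = 0 by rewrite h_line ?raddf0.
rewrite (surf_h surfA i) big_distrl (bigD1 L) // (bigD1 p) ?ip //= big1 => [|F]; last first.
  case/andP=> /andP[iF neFL] neFp; apply: xx_same neFL; rewrite (negPf nL).
  by apply: contraNF neFp => pF; apply/eqP/(point_inj loopM pF pp iF ip).
rewrite addr0 raddfD /= (deg_point_line pp nL); last exact: (point_sub loopM pp ip iL).
by move/eqP; rewrite addr_eq0 => /eqP.
Qed.

Lemma h_pointE p : point p -> h_ (val p) = 0.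
Proof.
move=> pp; have /and3P[_ /set0Pn[i ip] _] := valP p.
apply/eqP; rewrite /h_ (surf_h surfA i) subr_eq0; apply/eqP/eq_bigl => F.
apply/idP/idP => [iF|/subsetP]; last by apply.
exact: (point_sub loopM pp ip iF).
Qed.

Lemma h_lineE L : ~~ point L -> h_ (val L) = h - x L.
Proof.
move=> nL; rewrite /h_ (bigD1 L) //= big1 ?addr0 // => F /andP[sLF neF].
case/negP: neF; rewrite eq_sym; apply/eqP/(subset_rk loopM rk3 sLF).
by rewrite (negPf nL); apply/esym; apply: contraTF sLF => pF; apply: subset_line_point.
Qed.

(** Since [alpha_p = 0] for a point [p], the classes of points can be
    eliminated. *)
Lemma x_pointE p : point p ->
  x p = h - \sum_(L | ~~ point L && (val p \subset val L)) x L.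
Proof.
move=> pp; have /eqP := h_pointE pp; rewrite /h_ subr_eq0 => /eqP->.
rewrite (bigD1 p) //= -[LHS]addr0 -addrA; congr (_ + _); apply/esym/eqP; rewrite subr_eq0.
apply/eqP/eq_bigl => F; rewrite andbC; case: (boolP (val p \subset val F)) => spF; rewrite ?andbF // !andbT.
have [pF|nF] := boolP (point F); last by apply: contraTneq pp => <-.
by rewrite (subset_rk loopM rk3 spF) ?eqxx // pF pp.
Qed.

Lemma ishomog2E q : ishomog 2 q -> q = (h * h) *~ deg q.
Proof.
have dA : ishomog 2 (h * h) by apply: (surfM surfA); apply: ishomog_h.
move=> dq; apply/eqP; rewrite -subr_eq0; apply/eqP/(surf_deg_inj surfA).
  by apply: ishomogB => //; apply: ishomogMz.
by rewrite raddfB raddfMz /= deg_h2 ?intz ?subrr //; apply: ex_elt.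
Qed.

(** [A^3 = 0]: the class [alpha^2] of a point of the surface is orthogonal to
    every line [L] because [alpha x_L = 0], and to every point [p] because it
    also is the class of a flag through another point. *)
Lemma h2_x F : h * h * x F = 0.
Proof.
have [pF|nF] := boolP (point F); last by rewrite -mulrA h_line ?mulr0.
have [i iF] := pflat_notin F; have [p pp ip] := point_of loopM rk3 i.
have [j jp] := pflat_notin p; have [L nL /andP[_ pL]] := line_through rk3 pp jp.
have -> : h * h = x p * x L.
  have dpL : ishomog 2 (x p * x L) by apply: (surfM surfA); apply: (surfx surfA).
  by rewrite (ishomog2E dpL) deg_point_line.
rewrite mulrAC xx_same ?mul0r //; first by rewrite pp pF.
by apply: contraNneq iF => <-.
Qed.

Lemma ishomog1_ind (P : A -> Prop) :
  P 0 -> (forall l m, P l -> P m -> P (l + m)) -> (forall l, P l -> P (- l)) ->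
  (forall F, P (x F)) -> forall l, ishomog 1 l -> P l.
Proof.
move=> P0 PD PN Px l /(surf_span surfA)[c ->]; apply: big_ind => // F _.
have PMn n : P (x F *+ n) by elim: n => [|n IHn]; rewrite ?mulr0n // mulrS; apply: PD.
by case: (c F) => n; rewrite ?NegzE ?mulrNz -pmulrn //; apply: PN.
Qed.

Lemma mul_deg12 l q : ishomog 1 l -> ishomog 2 q -> l * q = 0.
Proof.
move=> dl /ishomog2E->; rewrite mulrzAr [l * _]mulrC.
suff -> : h * h * l = 0 by rewrite mul0rz.
apply: (ishomog1_ind (P := fun l => h * h * l = 0)) dl.
- by rewrite mulr0.
- by move=> l1 l2 Pl1 Pl2; rewrite mulrDr Pl1 Pl2 addr0.
- by move=> l1 Pl1; rewrite mulrN Pl1 oppr0.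
- exact: h2_x.
Qed.

Lemma mul_deg22 q q' : ishomog 2 q -> ishomog 2 q' -> q * q' = 0.
Proof.
move=> /ishomog2E-> dq'; rewrite mulrzAl -mulrA (mul_deg12 (q := q')) //; last exact: ishomog_h.
by rewrite mulr0 mul0rz.
Qed.

(** The classes [alpha] and [x_L] form an orthogonal basis of [A^1], with one
    positive square and all the others equal to [-1]; this is the expansion in
    that basis. *)
Lemma line_expansion l : ishomog 1 l ->
  l = h *~ deg (h * l) - \sum_(L | ~~ point L) x L *~ deg (x L * l).
Proof.
apply: (ishomog1_ind (P := fun l => l = h *~ deg (h * l)
   - \sum_(L | ~~ point L) x L *~ deg (x L * l))).
- by rewrite mulr0 raddf0 big1 ?subr0 // => L _; rewrite mulr0 raddf0.
- move=> l1 l2 El1 El2; rewrite {1}El1 {1}El2 mulrDr raddfD mulrzDr.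
  under [in RHS]eq_bigr do rewrite mulrDr raddfD mulrzDr.
  by rewrite big_split opprD addrACA.
- move=> l1 El1; rewrite {1}El1 mulrN raddfN mulrNz opprB.
  under [in RHS]eq_bigr do rewrite mulrN raddfN mulrNz.
  by rewrite sumrN opprK addrC.
move=> F; have [pF|nF] := boolP (point F).
  rewrite {1}x_pointE // deg_h_point //; congr (_ - _).
  rewrite big_mkcondr; apply: eq_bigr => L nL; rewrite mulrC; case: ifPn => sFL.
    by rewrite deg_point_line.
  by rewrite x_incomparable ?raddf0 // (comparable_point_line loopM rk3).
rewrite h_line // raddf0 (bigD1 F) //= deg_lineline // big1 => [|L /andP[nL neL]].
  by rewrite sub0r addr0 mulrNz opprK.
by rewrite xx_same ?raddf0 // (negPf nF) (negPf nL).
Qed.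

Lemma deg_sq l : ishomog 1 l ->
  deg (l * l) = deg (h * l) ^+ 2 - \sum_(L | ~~ point L) deg (x L * l) ^+ 2.
Proof.
move=> dl; rewrite {1}(line_expansion dl) mulrBl raddfB /= mulrzAl raddfMz mulrzz.
rewrite mulr_suml (raddf_sum deg).
rewrite -expr2.
congr (_ - _).
apply: eq_bigr => L _.
by rewrite mulrzAl (raddfMz deg) /= mulrzz expr2.
Qed.

(** The analogue of the anticanonical class in a Riemann-Roch formula: it is
    determined by [deg (alpha kappa) = 1] and [deg (alpha_L kappa) = 0]. *)
Definition kappa : A := h - \sum_(L | ~~ point L) x L.

Lemma deg_kappa l :
  deg (l * kappa) = deg (h * l) - \sum_(L | ~~ point L) deg (x L * l).
Proof. by rewrite mulrC mulrBl raddfB mulr_suml raddf_sum. Qed.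

(** [u] is [1 + l + q] where the degree two part [q] is half of
    [l (l + kappa)]: the shape of the class of the line bundle with first Chern
    class [l]. *)
Definition rr_class l u := exists q,
  [/\ u = 1 + l + q, ishomog 2 q & deg q + deg q = deg (l * l) + deg (l * kappa)].

(** The quadratic part of [l (l + kappa)] is accounted for by the cross term of
    the product, so the formula is preserved by tensor product... *)
Lemma rr_classM l m u v : ishomog 1 l -> ishomog 1 m ->
  rr_class l u -> rr_class m v -> rr_class (l + m) (u * v).
Proof.
move=> dl dm [q [-> dq Eq]] [r [-> dr Er]].
have dlm : ishomog 2 (l * m) by apply: (surfM surfA).
exists (q + r + l * m); split.
- have lr := mul_deg12 dl dr; have mq := mul_deg12 dm dq; have qr := mul_deg22 dq dr.
  transitivity (1 + (l + m) + (q + r + l * m) + (l * r + m * q + q * r)); last first.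
    by rewrite lr mq qr !addr0.
  by ring.
- by do !apply: (surfD surfA).
- have -> : (l + m) * (l + m) = l * l + m * m + (l * m + l * m) by ring.
  rewrite mulrDl !raddfD /=; move: Eq Er.
  move: (deg q) (deg r) (deg (l * m)) (deg (l * l)) (deg (m * m)).
  by move: (deg (l * kappa)) (deg (m * kappa)) => *; lia.
Qed.

(** ... and by inversion. *)
Lemma rr_classV l u v : ishomog 1 l -> rr_class l u -> u * v = 1 ->
  exists q, [/\ v = 1 - l + q, ishomog 2 q & deg q + deg q = deg (l * l) - deg (l * kappa)].
Proof.
move=> dl [q [-> dq Eq]] uv; have dll : ishomog 2 (l * l) by apply: (surfM surfA).
have lll := mul_deg12 dl dll; have lq := mul_deg12 dl dq; have qll := mul_deg22 dq dll.
have qq := mul_deg22 dq dq.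
exists (l * l - q); split.
- transitivity ((1 + l + q) * v * (1 - l + (l * l - q))); last by rewrite uv mul1r.
  transitivity (v * (1 + l * (l * l) - (l * q + l * q) + q * (l * l) - q * q)); last by ring.
  by rewrite lll lq qll qq !(addr0, subr0) mulr1.
- exact: ishomogB.
- rewrite raddfB /=; move: Eq.
  by move: (deg q) (deg (l * l)) (deg (l * kappa)) => *; lia.
Qed.

Lemma rr_class_h : rr_class h (1 + h + h * h).
Proof.
exists (h * h); split=> //; first by apply: (surfM surfA); apply: ishomog_h.
rewrite deg_kappa big1 ?subr0 // => L nL; by rewrite mulrC h_line ?raddf0.
Qed.

Lemma rr_class_h_line L : ~~ point L -> let a := h_ (val L) in
  rr_class a (1 + a + a * a).
Proof.
move=> nL a; exists (a * a); split=> //; first by apply: (surfM surfA); apply: ishomog_h_.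
congr (_ + _); rewrite deg_kappa /a h_lineE //.
have Daa : deg ((h - x L) * (h - x L)) = 0.
  rewrite mulrBr !mulrBl (mulrC (x L)) h_line // sub0r subr0 opprK raddfD /=.
  by rewrite deg_h2 ?deg_lineline //; apply: ex_elt.
rewrite Daa mulrBr raddfB /= deg_h2 ?h_line ?raddf0 ?subr0 //; last exact: ex_elt.
rewrite (bigD1 L) //= mulrBr mulrC h_line // sub0r raddfN /= deg_lineline // opprK.
rewrite big1 ?addr0 ?subrr // => L' /andP[nL' neL].
by rewrite mulrBr mulrC h_line // sub0r xx_same ?oppr0 ?raddf0 // (negPf nL) (negPf nL').
Qed.

Definition div_class (c : pflat M -> int) : A := \sum_F x F *~ c F.

Lemma div_classD c d : div_class (fun F => c F + d F) = div_class c + div_class d.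
Proof. by rewrite -big_split; apply: eq_bigr => F _; rewrite mulrzDr. Qed.

Lemma div_classN c : div_class (fun F => - c F) = - div_class c.
Proof. by rewrite -sumrN; apply: eq_bigr => F _; rewrite mulrNz. Qed.

Lemma ishomog_div_class c : ishomog 1 (div_class c).
Proof.
apply: big_ind => [||F _]; [exact: (surf0 surfA) | exact: (surfD surfA) |].
by apply/ishomogMz/(surfx surfA).
Qed.

Lemma h_setT : h_ [set: E] = h.
Proof.
rewrite /h_ big1 ?subr0 // => F; rewrite subTset => /eqP FT.
by have /and3P[_ _] := valP F; rewrite FT eqxx.
Qed.

Section Multiplicative.
Variable Z : (pflat M -> int) -> A.
Hypothesis ZD : forall c d, Z (fun F => c F + d F) = Z c * Z d.
Hypothesis ZN : forall c, Z c * Z (fun F => - c F) = 1.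
Hypothesis Z_h_ : forall (F : {set E}) c, flat M F -> F != set0 ->
  div_class c = h_ F -> Z c = 1 + h_ F + h_ F * h_ F.

(** [alpha_p = 0] for a point [p], so the value of [Z] prescribed for this flat
    says that [Z] is trivial on principal divisors. *)
Lemma Z_class_eq c d : div_class c = div_class d -> Z c = Z d.
Proof.
move=> Ecd; have [p pp _] := point_of loopM rk3 ex_elt.
have /and3P[flp p0 _] := valP p.
have := Z_h_ (c := fun F => c F + - d F) flp p0.
rewrite h_pointE // div_classD div_classN Ecd subrr.
move/(_ erefl); rewrite mulr0 !addr0 ZD => cd1.
by rewrite -[LHS]mulr1 -(ZN d) mulrCA cd1 mulr1.
Qed.

(** The divisor classes [alpha] and [alpha_L] on which [Z] is prescribed
    generate [A^1], and the formula is compatible with products and inverses. *)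
Lemma Z_rr_class c : rr_class (div_class c) (Z c).
Proof.
pose Q l := exists2 d, div_class d = l & rr_class l (Z d).
suff [d Ed] : Q (div_class c) by rewrite (Z_class_eq Ed).
have QD l m : Q l -> Q m -> Q (l + m).
  move=> [a <- Ra] [b <- Rb]; exists (fun F => a F + b F); first exact: div_classD.
  by rewrite ZD; apply: rr_classM => //; exact: ishomog_div_class.
have QN l : Q l -> Q (- l).
  move=> [a <- Ra]; exists (fun F => - a F); first exact: div_classN.
  have [q [-> dq Eq]] := rr_classV (ishomog_div_class a) Ra (ZN a).
  by exists q; split; rewrite // mulrNN Eq mulNr raddfN.
have QB l m : Q l -> Q m -> Q (l - m) by move=> Ql /QN; apply: QD.
have Qh : Q h.
  have [a Ea] := surf_span surfA (ishomog_h_ [set: E]).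
  exists a; first by rewrite -h_setT Ea.
  have T0 : [set: E] != set0 by apply/set0Pn; exists ex_elt; rewrite inE.
  have flT : flat M [set: E] by apply/forall_inP => e; rewrite !inE.
  by rewrite (Z_h_ flT T0 (esym Ea)) h_setT; apply: rr_class_h.
have Qline L : ~~ point L -> Q (x L).
  move=> nL; have -> : x L = h - h_ (val L).
    by rewrite h_lineE // opprB addrC subrK.
  apply: QB => //; have [a Ea] := surf_span surfA (ishomog_h_ (val L)).
  exists a => //; have /and3P[flL L0 _] := valP L.
  by rewrite (Z_h_ flL L0 (esym Ea)); apply: rr_class_h_line.
have Q0 : Q 0 by rewrite -(subrr h); apply: QB.
apply: ishomog1_ind (ishomog_div_class c) => // F.
have [pF|/Qline//] := boolP (point F).
rewrite x_pointE //; apply: QB => //.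
by apply: big_ind => // L /andP[/Qline].
Qed.

End Multiplicative.

Lemma sum_binom_le (I : finType) (P : pred I) (e : I -> int) (d : int) :
  (forall i, P i -> 0 <= e i) -> \sum_(i | P i) e i <= d ->
  d - \sum_(i | P i) e i <= d ^+ 2 - \sum_(i | P i) e i ^+ 2.
Proof.
set S := \sum_(i | P i) e i => e0 leSd.
have leS i : P i -> e i <= S.
  by move=> Pi; rewrite /S (bigD1 i) //= lerDl sumr_ge0 // => j /andP[/e0].
have S0 : 0 <= S by apply: sumr_ge0.
have : \sum_(i | P i) e i ^+ 2 - S <= S * S - S.
  have -> : S * S - S = \sum_(i | P i) e i * (S - 1).
    by rewrite -mulr_suml mulrBr mulr1.
  rewrite /S -sumrB; apply: ler_sum => i Pi; rewrite -/S.
  by have := e0 i Pi; have := leS i Pi; nia.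
rewrite lerBlDr subrK => leT; apply: (@le_trans _ _ (d ^+ 2 - S * S)); last by rewrite lerB.
rewrite -subr_ge0 (_ : _ - _ = (d - S) * (d + S - 1)); last by ring.
have [->|neq] := eqVneq d S; first by rewrite subrr mul0r.
by rewrite mulr_ge0 ?subr_ge0 //; move/eqP: neq; clearbody S; lia.
Qed.

(** If [d = l alpha] is at most the sum of the [e_L = l x_L], then [l kappa] is
    nonpositive while the square of [l] is nonnegative. Otherwise the claim is
    superadditivity of binomial coefficients, since [l^2] is [d^2] minus the
    sum of the [e_L^2]. *)
Lemma deg_kappa_le l : ishomog 1 l -> (forall F, 0 <= deg (x F * l)) ->
  0 <= deg (l * l) -> deg (l * kappa) <= deg (l * l).
Proof.
move=> dl lx ll; rewrite deg_kappa.
have [le_d|/ltW ge_d] := leP (deg (h * l)) (\sum_(L | ~~ point L) deg (x L * l)).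
  by apply: le_trans ll; rewrite subr_le0.
by rewrite (deg_sq dl); apply: sum_binom_le.
Qed.

End Surface.

(** * The cone of nef products *)

Section Cone.
Variables (E : finType) (M : matroid E).

Lemma nef_products1 (l : chow M int) : nef_products 1 l <-> comb_nef l.
Proof.
split=> [[t nt ->]|nl]; first by rewrite big_ord1.
by exists [tuple l] => [j|]; [rewrite [j]ord1 | rewrite big_ord1].
Qed.

Lemma nef_productsX i (l : chow M int) : comb_nef l -> nef_products i (l ^+ i).
Proof.
move=> nl; exists [tuple of nseq i l] => [j|]; first by rewrite tnth_nseq.
by under eq_bigr do rewrite tnth_nseq; rewrite prodr_const card_ord.
Qed.

(** For each flag, the conditions on an expression of a divisor are preserved
    by nonnegative linear combinations. *)
Lemma nef_cone1 (l : chow M int) : nef_cone rat 1 l -> comb_nef l.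
Proof.
case=> dl [s [Ps El]]; split=> // S; rewrite {}El.
elim: s Ps => [|p s IHs] Ps.
  exists (fun=> 0); rewrite big_nil; split=> //.
  by rewrite big1 // => F _; rewrite scale0r rmorph0.
have [|c [Ec cS c0]] := IHs; first by move=> q qs; apply: Ps; rewrite inE qs orbT.
have [p0 /nef_products1[_ /(_ S)[d [Ed dS d0]]]] := Ps p (mem_head _ _).
exists (fun F => p.1 * d F + c F); split=> [|F FS|F FS flF].
- rewrite big_cons Ec Ed mulr_sumr -big_split; apply: eq_bigr => F _ /=.
  by rewrite -rmorphM -rmorphD mul_mpolyC scalerA scalerDl.
- by rewrite dS ?cS // mulr0 addr0.
- by rewrite addr_ge0 ?mulr_ge0 ?d0 ?c0.
Qed.

Lemma nef_cone_int_rat i (a : chow M int) : nef_cone int i a -> nef_cone rat i a.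
Proof.
case=> da [s [Ps Ea]]; split=> //; exists [seq (p.1%:~R, p.2) | p <- s]; split.
  by move=> _ /mapP[p /Ps[p0 Np] ->]; rewrite ler0z.
rewrite -[a]chow_ext_int Ea (big_morph _ (@chow_extD _ M rat) (@chow_ext0 _ M rat)) big_map.
apply: eq_bigr => p _; rewrite chow_ext_int -chow_extMz; congr chow_ext.
by rewrite -{1}[p.1]intz -{1}[p.2]chow_ext_int -chow_extMz chow_ext_int.
Qed.

Lemma nef_cone_int_mul i (a b : chow M int) (n : int) : chow_deg i b ->
  nef_products i b -> 0 <= n -> a = b *~ n -> nef_cone int i a.
Proof.
move=> db Nb n0 ->; split; first exact: chow_degMz.
exists [:: (n, b)]; split=> [p /[1!inE] /eqP->|] //.
by rewrite big_seq1 /= chow_extMz intz.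
Qed.

End Cone.

(** * Degrees of nef divisors *)

Section Nef.
Variables (E : finType) (M : matroid E).
Hypotheses (loopM : loopless M) (rk3 : rank M = 3%N).
Variable deg : {additive chow M int -> int}.
Hypothesis degM : is_degree_map deg.
Implicit Types (F G p L : pflat M) (l m q : chow M int).

Lemma deg_off i l : i != 2%N -> chow_deg i l -> deg l = 0.
Proof. by case: degM => + _ _ _; rewrite rk3; apply. Qed.

Lemma chow_surface : surface_ring (@x_ E M) (alpha M) (@chow_deg E M int) deg.
Proof.
split.
- exact: chow_deg0.
- exact: chow_degD.
- exact: chow_degN.
- move=> a b; exact: chow_degM.
- exact: x_deg1.
- by move=> a /chow_deg1E.
- exact: alphaE.
- exact: x_incomparable.
- move=> p L pp nL spL; have neq : p != L by apply: contraTneq pp => ->.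
  have flS : is_flag [set p; L].
    apply/forall_inP => F; rewrite !inE => /orP[]/eqP->; apply/forall_inP => G;
    by rewrite !inE => /orP[]/eqP->; rewrite /Defs.comparable ?subxx ?spL ?orbT.
  pose S : flag M := exist (fun S : {set pflat M} => is_flag S) _ flS.
  case: degM => _ /(_ S) + _ _; rewrite /= cards2 neq rk3.
  by rewrite big_setU1 ?inE // big_set1; apply.
- by case: degM => _ _ + _; rewrite rk3; apply.
Qed.

Let flag_of (A : {set pflat M}) (flA : is_flag A) : flag M :=
  exist (fun A : {set pflat M} => is_flag A) A flA.

Lemma is_flag0 : is_flag (set0 : {set pflat M}).
Proof. by apply/forall_inP => F; rewrite inE. Qed.

Lemma is_flag1 F : is_flag [set F].
Proof.
apply/forall_inP => G /set1P->; apply/forall_inP => H /set1P->.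
by rewrite /Defs.comparable subxx.
Qed.

Lemma is_flag2 F G : is_flag (F |: [set G]) = Defs.comparable (val F) (val G).
Proof.
apply/'forall_in_'forall_in_idP/idP => [flFG|cFG H HFG K KFG].
  by apply: flFG; rewrite !inE eqxx ?orbT.
move: HFG KFG; rewrite !inE => /orP[]/eqP-> /orP[]/eqP->;
  by rewrite ?cFG // /Defs.comparable ?subxx // orbC.
Qed.

(** The expression of [l] adapted to the flag [F] avoids the curve of [F]. *)
Lemma nef_deg_x l F : comb_nef l -> 0 <= deg (x_ F * l).
Proof.
case=> _ /(_ (flag_of (is_flag1 F)))[c [Ec cF c0]]; rewrite mulrC.
rewrite -(ler0z rat) (deg_rat_expr deg (x_ F) Ec); apply: sumr_ge0 => G _.
have [->|neGF] := eqVneq G F; first by rewrite cF ?inE // mul0r.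
have [cGF|/x_incomparable->] := boolP (Defs.comparable (val G) (val F)).
  by rewrite mulr_ge0 ?ler0z ?(deg_xx_ge0 loopM rk3 chow_surface) // c0 ?is_flag2 //= inE.
by rewrite raddf0 mulr0.
Qed.

(** The empty flag expresses [l] as an effective divisor. *)
Lemma nef_deg_sq l : comb_nef l -> 0 <= deg (l * l).
Proof.
move=> nl; have [_ /(_ (flag_of is_flag0))[c [Ec _ c0]]] := nl.
rewrite -(ler0z rat) (deg_rat_expr deg l Ec); apply: sumr_ge0 => F _.
by rewrite mulr_ge0 ?ler0z ?nef_deg_x // c0 ?inE // setU0 is_flag1.
Qed.

Lemma nef_kappa_le l : comb_nef l ->
  deg (l * kappa (@x_ E M) (alpha M)) <= deg (l * l).
Proof.
move=> nl; apply: (deg_kappa_le loopM rk3 chow_surface).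
- by case: nl.
- by move=> F; apply: nef_deg_x.
- exact: nef_deg_sq.
Qed.

End Nef.

(** * The isomorphism zeta on line bundles *)

Section Zeta.
Variables (k : fieldType) (E : finType) (M : matroid E).
Hypotheses (loopM : loopless M) (rk3 : rank M = 3%N).
Variable deg : {additive chow M int -> int}.
Hypothesis degM : is_degree_map deg.
Variable zeta : {rmorphism K_ring k M -> chow M int}.
Hypothesis zetaM : is_zeta zeta.
Implicit Types (c d : pflat M -> int).

Let surface := chow_surface rk3 degM.
Let kappaM := kappa (@x_ E M) (alpha M).
Let Z c := zeta (K_class (line_bundle k c)).

Lemma zeta_lineD c d : Z (fun F => c F + d F) = Z c * Z d.
Proof. by rewrite /Z K_lineD rmorphM. Qed.

Lemma zeta_lineN c : Z c * Z (fun F => - c F) = 1.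
Proof. by rewrite /Z -rmorphM K_lineN rmorph1. Qed.

Lemma zeta_alpha_ (F : {set E}) c : flat M F -> F != set0 ->
  div_class (@x_ E M) c = alpha_ M F ->
  Z c = 1 + alpha_ M F + alpha_ M F * alpha_ M F.
Proof.
move=> flF F0 Dc; rewrite /Z; case: zetaM => _ /(_ F (line_bundle k c) flF F0) ->.
  by rewrite rk3 !big_ord_recl big_ord0 addr0 addrA expr2 expr0 expr1.
by rewrite -Dc; apply: has_c1_line.
Qed.

Lemma zeta_inverse (L L' : bundle k M 1) l : has_c1 L l -> inverse_bundle L L' ->
  exists q, [/\ zeta (K_class L') = 1 - l + q, chow_deg 2 q
    & deg q + deg q = deg (l * l) - deg (l * kappaM)].
Proof.
case=> c isoL -> /K_inverse LL'.
have uv : Z c * zeta (K_class L') = 1.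
  by rewrite /Z -rmorphM -(K_isom isoL) LL' rmorph1.
exact: (rr_classV loopM rk3 surface (ishomog_div_class surface c)
  (Z_rr_class loopM rk3 surface zeta_lineD zeta_lineN zeta_alpha_ c) uv).
Qed.

Lemma chow_part_sum3 (l q : chow M int) i : chow_deg 1 l -> chow_deg 2 q -> (i < 3)%N ->
  chow_part i (1 - l + q) = [:: 1; - l; q]`_i.
Proof.
move=> dl dq; rewrite !chow_partD (chow_part_deg _ (chow_deg1 M int)).
rewrite (chow_part_deg _ (chow_degN dl)) (chow_part_deg _ dq).
by move: (- l) => l'; case: i => [|[|[|]]] //= _; rewrite ?addr0 ?add0r.
Qed.

(** The degree one part of [zeta] at the inverse bundle is [- l]. *)
Lemma calP_nef l : calP rat zeta l -> comb_nef l.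
Proof.
case=> dl Pl; have /chow_deg1E[c Ec] := dl; apply: nef_cone1.
have cL : has_c1 (line_bundle k c) l by rewrite Ec; apply: has_c1_line.
have [q [Eq dq _]] := zeta_inverse cL (inverse_line k c).
have := Pl _ _ cL (inverse_line k c) 1%N; rewrite rk3 Eq chow_part_sum3 //= expr1 mulN1r opprK.
exact.
Qed.

Lemma nef_calP l : comb_nef l -> calP int zeta l.
Proof.
move=> nl; have [dl _] := nl; split=> // L L' cL LL' i; rewrite rk3 => lti.
have [q [-> dq Eq]] := zeta_inverse cL LL'; rewrite chow_part_sum3 //.
have nA : comb_nef (alpha M) by apply/comb_nef_alpha/(ex_elt rk3).
case: i lti => [|[|[|]]] //= _.
- apply: (nef_cone_int_mul (n := 1) (chow_deg1 M int) (nef_productsX 0 nA)) => //.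
  by rewrite expr0 mulr1.
- apply: (nef_cone_int_mul (n := 1) dl (nef_productsX 1 nl)) => //.
  by rewrite expr1 mulN1r opprK.
have dA := surfM surface (alpha_deg1 M) (alpha_deg1 M).
apply: (nef_cone_int_mul (n := deg q) dA (nef_productsX 2 nA)).
  have := nef_kappa_le loopM rk3 degM nl; rewrite -subr_ge0 -Eq.
  by move: (deg q) => n; lia.
by rewrite sqrrN expr1n mul1r; apply: (ishomog2E loopM rk3 surface).
Qed.

Lemma nef_deg_zeta l (L L' : bundle k M 1) : comb_nef l -> has_c1 L l ->
  inverse_bundle L L' -> 0 <= deg (zeta (K_class L')).
Proof.
move=> nl cL LL'; have [dl _] := nl; have [q [-> dq Eq]] := zeta_inverse cL LL'.
rewrite !raddfD raddfN /= (deg_off rk3 degM (i := 0%N) isT (chow_deg1 M int)) //.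
rewrite (deg_off rk3 degM (i := 1%N) isT dl) // oppr0 !add0r.
have := nef_kappa_le loopM rk3 degM nl; rewrite -subr_ge0 -Eq.
by move: (deg q) => n; lia.
Qed.

End Zeta.

Theorem theorem5p23 (k : fieldType) (E : finType) (M : matroid E)
    (zeta : {rmorphism K_ring k M -> chow M int})
    (deg : {additive chow M int -> int}) :
  loopless M -> rank M = 3%N -> is_zeta zeta -> is_degree_map deg ->
  [/\ forall l : chow M int, calP rat zeta l <-> comb_nef l,
      forall l : chow M int, calP int zeta l <-> comb_nef l
    & forall (l : chow M int) (L L' : bundle k M 1),
        comb_nef l -> has_c1 L l -> inverse_bundle L L' ->
        0 <= (-1) ^+ (rank M).-1 * deg (zeta (K_class L'))].
Proof.
move=> loopM rk3 zetaM degM.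
have int_rat l : calP int zeta l -> calP rat zeta l.
  case=> dl Pl; split=> // L L' cL LL' i lti; apply: nef_cone_int_rat.
  exact: (Pl L L').
have rat_nef l : calP rat zeta l -> comb_nef l.
  exact: (calP_nef loopM rk3 degM zetaM).
have nef_int l : comb_nef l -> calP int zeta l.
  exact: (nef_calP loopM rk3 degM zetaM).
split=> [l|l|l L L' nl cL LL'].
- by split=> [/rat_nef|/nef_int/int_rat].
- by split=> [/int_rat/rat_nef|/nef_int].
rewrite rk3 sqrrN expr1n mul1r.
exact: (nef_deg_zeta loopM rk3 degM zetaM nl cL LL').
Qed.
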